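(* Every Cappell–Shaneson matrix of trace $n$ is Gompf equivalent to $A_0=X_{1,1,2}$ (equivalently, every $(c,d,n)\in\mathcal{CS}$ is Gompf equivalent to $(1,1,2)$), whenever $-64\le n\le 69$ or $n\in\{-73,-69,-67,-66,71,72,74,78\}$.
   Context: $f_n(x)=x^3-nx^2+(n-1)x-1$. A Cappell–Shaneson (CS) matrix is $A\in SL(3;\mathbb{Z})$ with $\det(A-I)=1$; its trace is $\operatorname{tr}A$. Let $\mathcal{CS}=\{(c,d,n)\in\mathbb{Z}^3 : d\neq 0,\ f_n(c)\equiv 0 \pmod d\}$. For $(c,d,n)\in\mathcal{CS}$ let $X_{c,d,n}=\begin{bmatrix}0&a&b\\0&c&d\\1&0&n-c\end{bmatrix}$ with $b=(c-1)(n-c-1)$ and $a=-f_n(c)/d$ (so $ad-bc=1$); this is the unique CS matrix of this shape, and $(c,d,n)\mapsto X_{c,d,n}$ is a bijection from $\mathcal{CS}$ to such ''standard'' CS matrices. Two matrices $A,B\in SL(3;\mathbb{Z})$ are similar if $B=PAP^{-1}$ for some $P\in SL(3;\mathbb{Z})$. Gompf equivalence $\sim$ on $\mathcal{CS}$ is the equivalence relation generated by: (i) $(c,d,n)\sim(c',d',n')$ whenever $X_{c,d,n}$ and $X_{c',d',n'}$ are similar; (ii) $(c,d,n)\sim(c,d,n+kd)$ for all $k\in\mathbb{Z}$. Two standard CS matrices are Gompf equivalent if their triples are, and a general CS matrix is Gompf equivalent to $A_0$ if it is similar to a standard CS matrix Gompf equivalent to $X_{1,1,2}$ (every CS matrix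 is similar to a standard one). *)

(* Defs.v *)
From HB Require Import structures.
From mathcomp Require Import all_boot all_order all_algebra.
From Stdlib Require Import Relation_Operators.
Set Implicit Arguments. Unset Strict Implicit. Unset Printing Implicit Defensive.
Import Order.TTheory GRing.Theory Num.Theory.
Local Open Scope ring_scope.

Definition fCS (n x : int) : int := x ^+ 3 - n * x ^+ 2 + (n - 1) * x - 1.

Definition inCS (c d n : int) : Prop := d != 0 /\ (d %| fCS n c)%Z.

Definition mx3 (a00 a01 a02 a10 a11 a12 a20 a21 a22 : int) : 'M[int]_3 :=
  \matrix_(i < 3, j < 3)
    nth 0 (nth [::] [:: [:: a00; a01; a02]; [:: a10; a11; a12]; [:: a20; a21; a22]] i) j.

Definition Xmx (c d n : int) : 'M[int]_3 :=
  let b := (c - 1) * (n - c - 1) in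
  let a := - (fCS n c %/ d)%Z in
  mx3 0 a b 0 c d 1 0 (n - c).

Definition isCSmx (A : 'M[int]_3) : Prop := \det A = 1 /\ \det (A - 1%:M) = 1.

Definition similar3 (A B : 'M[int]_3) : Prop :=
  exists P : 'M[int]_3, \det P = 1 /\ B = P *m A *m invmx P.

Definition gompf_step (t t' : int * int * int) : Prop :=
  let: (c, d, n) := t in
  let: (c', d', n') := t' in
  inCS c d n /\ inCS c' d' n' /\
  (similar3 (Xmx c d n) (Xmx c' d' n')
   \/ (c' = c /\ d' = d /\ exists k : int, n' = n + k * d)).

Definition gompf_equiv (t t' : int * int * int) : Prop :=
  clos_refl_sym_trans _ gompf_step t t'.

Definition gompf_equiv_A0 (A : 'M[int]_3) : Prop :=
  exists c d n, inCS c d n /\ similar3 A (Xmx c d n) /\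
                gompf_equiv (c, d, n) (1, 1, 2).

(* Main.v *)
(* A matrix A with det A = det (A - I) = 1 makes Z^3 a rank one module over Z[A]. The
   cubic form v |-> det (v, Av, A^2 v) is anisotropic, because the characteristic
   polynomial is irreducible modulo 2; moving a vector that minimizes its absolute value
   m to the first basis vector puts A in Hessenberg form with subdiagonal p, q and
   m = p^2 q. A geometry of numbers argument bounds m by (4/27) sqrt D, with D the
   discriminant of the characteristic polynomial, which leaves finitely many matrices for
   each trace n. In a standard form X_{c,d,n} the trace only matters modulo d, so by
   induction on |n - 5/2| it is enough to find, in each remaining similarity class, a
   standard form whose d brings n into the range already treated. This works directly
   for all but 112 matrices; those are connected to that range by explicit paths that may
   pass through larger traces. The induction starts with the traces 0 to 5, of complex
   cubic fields, where a Euclidean division shows m = 1. *)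

From Stdlib Require Import ZArith Reals Psatz List FMapPositive Classical Relation_Operators.
Import ListNotations.
Local Open Scope Z_scope.

(** * Integral 3x3 matrices and the index form *)

Record mat := Mat
  { a11 : Z; a12 : Z; a13 : Z; a21 : Z; a22 : Z; a23 : Z; a31 : Z; a32 : Z; a33 : Z }.
Definition vec : Type := Z * Z * Z.

Definition mat_mul (A B : mat) : mat :=
  let (a, b, c, d, e, f, g, h, i) := A in
  let (a', b', c', d', e', f', g', h', i') := B in
  Mat (a*a'+b*d'+c*g') (a*b'+b*e'+c*h') (a*c'+b*f'+c*i')
      (d*a'+e*d'+f*g') (d*b'+e*e'+f*h') (d*c'+e*f'+f*i')
      (g*a'+h*d'+i*g') (g*b'+h*e'+i*h') (g*c'+h*f'+i*i').
Definition app (A : mat) (v : vec) : vec :=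
  let (a, b, c, d, e, f, g, h, i) := A in
  let '(x, y, z) := v in (a*x+b*y+c*z, d*x+e*y+f*z, g*x+h*y+i*z).
Definition det (A : mat) : Z :=
  let (a, b, c, d, e, f, g, h, i) := A in
  a*(e*i-f*h) - b*(d*i-f*g) + c*(d*h-e*g).
Definition adj (A : mat) : mat :=
  let (a, b, c, d, e, f, g, h, i) := A in
  Mat (e*i-f*h) (c*h-b*i) (b*f-c*e)
      (f*g-d*i) (a*i-c*g) (c*d-a*f)
      (d*h-e*g) (b*g-a*h) (a*e-b*d).
Definition tr (A : mat) : Z := a11 A + a22 A + a33 A.
Definition sub1 (A : mat) : mat :=
  let (a, b, c, d, e, f, g, h, i) := A in Mat (a-1) b c d (e-1) f g h (i-1).
Definition one : mat := Mat 1 0 0 0 1 0 0 0 1.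
Definition cols (u v w : vec) : mat :=
  let '(a, d, g) := u in let '(b, e, h) := v in let '(c, f, i) := w in
  Mat a b c d e f g h i.

(** Conjugacy without inverses: once the determinant is 1, [adj] provides the inverse. *)
Definition sim (A B : mat) : Prop := exists P, det P = 1 /\ mat_mul P A = mat_mul B P.
Definition isCS (A : mat) : Prop := det A = 1 /\ det (sub1 A) = 1.

(* The index form: [iform A v] is, up to sign, the index in Z^3 of the Z[A]-submodule
   generated by [v]. *)
Definition iform (A : mat) (v : vec) : Z :=
  det (cols v (app A v) (app A (app A v))).

Definition vzero : vec := (0, 0, 0).
Definition e1 : vec := (1, 0, 0).

Ltac mat_ring :=
  repeat match goal with
         | A : mat |- _ => destruct A
         | v : vec |- _ => destruct v as [[? ?] ?]
         end;
  cbv beta iota zeta delta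
    [mat_mul app det adj tr sub1 one cols a11 a12 a13 a21 a22 a23 a31 a32 a33];
  first [ ring | f_equal; ring | f_equal; [f_equal|]; ring ].

Lemma mulA A B C : mat_mul A (mat_mul B C) = mat_mul (mat_mul A B) C. Proof. mat_ring. Qed.
Lemma mul1m A : mat_mul one A = A. Proof. mat_ring. Qed.
Lemma mulm1 A : mat_mul A one = A. Proof. mat_ring. Qed.
Lemma det_mul A B : det (mat_mul A B) = det A * det B. Proof. mat_ring. Qed.
Lemma tr_mulC A B : tr (mat_mul A B) = tr (mat_mul B A). Proof. mat_ring. Qed.
Lemma det_adj A : det (adj A) = det A * det A. Proof. mat_ring. Qed.
Lemma app_mul A B v : app (mat_mul A B) v = app A (app B v). Proof. mat_ring. Qed.
Lemma app_one v : app one v = v. Proof. mat_ring. Qed.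
Lemma app_zero A : app A vzero = vzero. Proof. unfold vzero; mat_ring. Qed.
Lemma mul_cols P u v w : mat_mul P (cols u v w) = cols (app P u) (app P v) (app P w).
Proof. mat_ring. Qed.
Lemma mul_adj_det A : mat_mul A (adj A) = Mat (det A) 0 0 0 (det A) 0 0 0 (det A).
Proof. mat_ring. Qed.
Lemma adj_mul_det A : mat_mul (adj A) A = Mat (det A) 0 0 0 (det A) 0 0 0 (det A).
Proof. mat_ring. Qed.
Lemma mul_adj A : det A = 1 -> mat_mul A (adj A) = one.
Proof. intros H; now rewrite mul_adj_det, H. Qed.
Lemma adj_mul A : det A = 1 -> mat_mul (adj A) A = one.
Proof. intros H; now rewrite adj_mul_det, H. Qed.
Lemma mul_sub1_r P A :
  mat_mul P (sub1 A) = let (a, b, c, d, e, f, g, h, i) := mat_mul P A in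
  let (a', b', c', d', e', f', g', h', i') := P in
  Mat (a-a') (b-b') (c-c') (d-d') (e-e') (f-f') (g-g') (h-h') (i-i').
Proof. mat_ring. Qed.
Lemma mul_sub1_l P A :
  mat_mul (sub1 A) P = let (a, b, c, d, e, f, g, h, i) := mat_mul A P in
  let (a', b', c', d', e', f', g', h', i') := P in
  Mat (a-a') (b-b') (c-c') (d-d') (e-e') (f-f') (g-g') (h-h') (i-i').
Proof. mat_ring. Qed.

Lemma sim_trans A B C : sim A B -> sim B C -> sim A C.
Proof.
intros [P [dP hP]] [Q [dQ hQ]]; exists (mat_mul Q P); split.
- now rewrite det_mul, dP, dQ.
- now rewrite <- mulA, hP, mulA, hQ, mulA.
Qed.

Lemma sim_inv P A B :
  det P = 1 -> mat_mul P A = mat_mul B P -> mat_mul (adj P) B = mat_mul A (adj P).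
Proof.
intros dP hP.
rewrite <- (mulm1 B), <- (mul_adj P dP), (mulA B P), <- hP, (mulA _ (mat_mul P A)), mulA.
now rewrite (adj_mul P dP), mul1m.
Qed.

Lemma sim_sym A B : sim A B -> sim B A.
Proof.
intros [P [dP hP]]; exists (adj P); split.
- now rewrite det_adj, dP.
- now apply sim_inv.
Qed.

Lemma sim_conj P A : det P = 1 -> sim A (mat_mul (mat_mul P A) (adj P)).
Proof.
intros dP; exists P; split; [easy |].
now rewrite <- mulA, (adj_mul P dP), mulm1.
Qed.

Lemma sim_isCS A B : sim A B -> isCS A -> isCS B.
Proof.
intros [P [dP hP]] [d1 d2]; split.
- generalize (f_equal det hP); rewrite !det_mul, dP, d1; lia.
- assert (h : mat_mul P (sub1 A) = mat_mul (sub1 B) P).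
  { now rewrite mul_sub1_r, mul_sub1_l, hP. }
  generalize (f_equal det h); rewrite !det_mul, dP, d2; lia.
Qed.

Lemma sim_tr A B : sim A B -> tr B = tr A.
Proof.
intros [P [dP hP]].
assert (h : B = mat_mul (mat_mul P A) (adj P)).
{ now rewrite hP, <- mulA, (mul_adj P dP), mulm1. }
now rewrite h, tr_mulC, mulA, (adj_mul P dP), mul1m.
Qed.

(** [P] carries the columns [v], [A v], [A^2 v] to the corresponding columns for [B], and its
    determinant is 1. *)
Lemma iform_sim P A B v :
  det P = 1 -> mat_mul P A = mat_mul B P -> iform B (app P v) = iform A v.
Proof.
intros dP hP; unfold iform.
assert (h : forall w, app B (app P w) = app P (app A w)).
{ now intros w; rewrite <- !app_mul, hP. }
now rewrite !h, <- mul_cols, det_mul, dP, Z.mul_1_l.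
Qed.

Lemma iform_scale A k x y z : iform A (k*x, k*y, k*z) = k*k*k * iform A (x, y, z).
Proof. unfold iform; mat_ring. Qed.

(* The characteristic polynomial of a Cappell-Shaneson matrix is x^3 + x + 1 or
   x^3 + x^2 + 1 modulo 2, hence irreducible. *)
Lemma iform_odd A x y z :
  isCS A -> (Z.odd x || Z.odd y || Z.odd z)%bool = true -> Z.odd (iform A (x, y, z)) = true.
Proof.
(* Everything is reduced modulo 2, which leaves a finite check over twelve booleans. *)
intros [h1 h2]; apply (f_equal Z.odd) in h1; apply (f_equal Z.odd) in h2; revert h1 h2.
destruct A as [a b c d e f g h i]; unfold iform; cbn [det sub1 cols app].
rewrite !Z.odd_add, !Z.odd_sub, !Z.odd_mul, !Z.odd_add, !Z.odd_sub, !Z.odd_mul.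
rewrite !Z.odd_add, !Z.odd_mul, !Z.odd_sub, !Z.odd_add, !Z.odd_mul.
change (Z.odd 1) with true.
generalize (Z.odd a) (Z.odd b) (Z.odd c) (Z.odd d) (Z.odd e) (Z.odd f) (Z.odd g) (Z.odd h)
  (Z.odd i) (Z.odd x) (Z.odd y) (Z.odd z).
clear; intros a b c d e f g h i.
destruct a, b, c, d, e, f, g, h, i; cbn; try discriminate; intros [] [] []; cbn; auto.
Qed.

(** Infinite descent: by [iform_odd] a zero has three even coordinates, and by homogeneity its half
    is again a zero. *)
Lemma iform_neq0 A v : isCS A -> v <> vzero -> iform A v <> 0.
Proof.
intros hA; destruct v as [[x y] z].
enough (H : forall k : nat, forall x y z, Z.abs x + Z.abs y + Z.abs z < Z.of_nat k ->
  iform A (x, y, z) = 0 -> x = 0 /\ y = 0 /\ z = 0).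
{ intros hv h0; apply hv.
  destruct (H (S (Z.to_nat (Z.abs x + Z.abs y + Z.abs z))) x y z) as [-> [-> ->]]; auto.
  lia. }
clear x y z; induction k as [|k IH]; intros x y z hk h0; [lia|].
destruct (Z.odd x || Z.odd y || Z.odd z)%bool eqn:ho.
{ apply (iform_odd A) in ho; auto; now rewrite h0 in ho. }
apply Bool.orb_false_elim in ho; destruct ho as [ho hz].
apply Bool.orb_false_elim in ho; destruct ho as [hx hy].
pose proof (Z.div2_odd x) as ex; pose proof (Z.div2_odd y) as ey.
pose proof (Z.div2_odd z) as ez; rewrite hx, hy, hz in *; cbn [Z.b2z] in *.
rewrite Z.add_0_r in ex, ey, ez.
revert ex ey ez; generalize (Z.div2 x) (Z.div2 y) (Z.div2 z); intros x' y' z' -> -> ->.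
rewrite iform_scale in h0.
destruct (Z.eq_dec x' 0), (Z.eq_dec y' 0), (Z.eq_dec z' 0); try lia;
  (assert (hh : iform A (x', y', z') = 0) by lia; apply IH in hh; lia).
Qed.

(** For [g = gcd x y] nonzero, the rows are Bezout coefficients and [(-y/g, x/g)]. *)
Lemma bezout_row x y : exists a b c d, a*d - b*c = 1 /\ c*x + d*y = 0.
Proof.
destruct (Z.eq_dec (Z.gcd x y) 0) as [h0|h0].
- apply Z.gcd_eq_0 in h0; destruct h0 as [-> ->]; exists 1, 0, 0, 1; lia.
- destruct (Z.gcd_bezout x y (Z.gcd x y) eq_refl) as [a [b hab]].
  destruct (Z.gcd_divide_l x y) as [x' hx], (Z.gcd_divide_r x y) as [y' hy].
  exists a, b, (-y'), x'; revert h0 hab hx hy; generalize (Z.gcd x y); intros g h0 hab -> ->.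
  split; [apply (Z.mul_reg_r _ _ g); auto|]; lia.
Qed.

Lemma primitive_first_column v : exists P g, det P = 1 /\ app P v = (g, 0, 0).
Proof.
destruct v as [[x y] z].
destruct (bezout_row y z) as [a [b [c [d [h1 h2]]]]].
destruct (bezout_row x (a*y+b*z)) as [a' [b' [c' [d' [h3 h4]]]]].
exists (mat_mul (Mat a' b' 0 c' d' 0 0 0 1) (Mat 1 0 0 0 a b 0 c d)).
exists (a'*x+b'*(a*y+b*z)); split.
- rewrite det_mul; cbn [det]; nia.
- rewrite app_mul; cbn [app]; f_equal; [f_equal|]; nia.
Qed.

(** * Vectors of least index and the Hessenberg form *)

Definition minimal (A : mat) : Prop :=
  forall v, v <> vzero -> Z.abs (iform A e1) <= Z.abs (iform A v).

(** A change of basis fixing [e1] up to sign preserves its index up to sign and permutes the nonzero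
    vectors; [k * k = 1] encodes the sign. *)
Lemma sim_minimal P A B k :
  det P = 1 -> mat_mul P A = mat_mul B P -> app P e1 = (k, 0, 0) -> k * k = 1 ->
  minimal A -> minimal B.
Proof.
intros dP hP he hk hA v hv.
assert (h1 : Z.abs (iform B e1) = Z.abs (iform A e1)).
{ rewrite <- (iform_sim P A B e1 dP hP), he.
  replace (k, 0, 0) with (k*1, k*0, k*0) by (f_equal; [f_equal|]; ring).
  rewrite iform_scale, hk; fold e1; nia. }
rewrite h1.
assert (h2 : app P (app (adj P) v) = v).
{ now rewrite <- app_mul, (mul_adj P dP), app_one. }
rewrite <- h2, (iform_sim P A B _ dP hP); apply hA.
intros h0; apply hv; now rewrite <- h2, h0, app_zero.
Qed.

(** A vector [v] of least absolute index is moved to [g] times [e1]; since the form is cubic, [e1]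
    then has absolute index at most that of [v]. *)
Lemma exists_minimal A : isCS A -> exists B, sim A B /\ minimal B.
Proof.
intros hA.
assert (H : exists v, v <> vzero /\ forall w, w <> vzero -> Z.abs (iform A v) <= Z.abs (iform A w)).
{ apply NNPP; intros hn.
  (* Without a minimum, every natural number would be a lower bound. *)
  assert (H : forall k : nat, forall v, v <> vzero -> Z.of_nat k <= Z.abs (iform A v)).
  { induction k as [|k IH]; intros v hv; [lia|].
    destruct (Z.eq_dec (Z.of_nat k) (Z.abs (iform A v))) as [e|ne].
    - exfalso; apply hn; exists v; split; auto; intros w hw; rewrite <- e; auto.
    - specialize (IH v hv); lia. }
  specialize (H (S (Z.to_nat (Z.abs (iform A e1)))) e1); 
  assert (he : e1 <> vzero) by discriminate; specialize (H he); lia. }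
destruct H as [v [hv hmin]].
destruct (primitive_first_column v) as [P [g [dP hg]]].
exists (mat_mul (mat_mul P A) (adj P)); split; [now apply sim_conj|].
set (B := mat_mul (mat_mul P A) (adj P)).
assert (hP : mat_mul P A = mat_mul B P).
{ unfold B; now rewrite <- mulA, (adj_mul P dP), mulm1. }
assert (hg0 : g <> 0).
{ intros ->; apply hv; rewrite <- (app_one v), <- (adj_mul P dP), app_mul, hg.
  apply app_zero. }
assert (h1 : Z.abs (iform B e1) <= Z.abs (iform A v)).
{ rewrite <- (iform_sim P A B v dP hP), hg.
  replace (g, 0, 0) with (g*1, g*0, g*0) by (f_equal; [f_equal|]; ring).
  rewrite iform_scale, !Z.abs_mul; fold e1.
  assert (hg1 : 0 < Z.abs g) by lia; assert (hi : 0 <= Z.abs (iform B e1)) by lia.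
  revert hg1 hi; generalize (Z.abs g) (Z.abs (iform B e1)); intros x y hx hy.
  assert (1 <= x * x) by nia; assert (1 <= x * x * x) by nia; nia. }
intros w hw; apply (Z.le_trans _ _ _ h1).
assert (h2 : app P (app (adj P) w) = w).
{ now rewrite <- app_mul, (mul_adj P dP), app_one. }
rewrite <- h2, (iform_sim P A B _ dP hP); apply hmin.
intros h0; apply hw; now rewrite <- h2, h0, app_zero.
Qed.

Lemma conj_minimal P k A B :
  det P = 1 -> app P e1 = (k, 0, 0) -> k * k = 1 -> sim A B /\ minimal B ->
  sim A (mat_mul (mat_mul P B) (adj P)) /\ minimal (mat_mul (mat_mul P B) (adj P)).
Proof.
intros dP he hk [h1 h2]; split.
- apply (sim_trans _ _ _ h1); now apply sim_conj.
- apply (sim_minimal P B _ k); auto.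
  now rewrite <- mulA, (adj_mul P dP), mulm1.
Qed.

Ltac mat_red := cbv beta iota zeta delta
  [mat_mul app det adj tr sub1 one cols e1 iform a11 a12 a13 a21 a22 a23 a31 a32 a33].

Ltac vec_ring := mat_red; apply f_equal2; [apply f_equal2|]; ring.

Lemma exists_hessenberg A : isCS A ->
  exists r s a p t b q u, let H := Mat r s a p t b 0 q u in
  (sim A H /\ minimal H) /\ 0 < p /\ 0 < q /\ 0 <= r < p /\ 0 <= u < q /\ 0 <= b < p.
Proof.
intros hA.
destruct (exists_minimal A hA) as [B hB].
(* A Bezout matrix acting on the last two coordinates clears the lower left entry and fixes [e1]. *)
assert (H : exists B, (sim A B /\ minimal B) /\ a31 B = 0).
{ destruct (bezout_row (a21 B) (a31 B)) as [a [b [c [d [h1 h2]]]]].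
  exists (mat_mul (mat_mul (Mat 1 0 0 0 a b 0 c d) B) (adj (Mat 1 0 0 0 a b 0 c d))); split.
  - apply (conj_minimal _ 1); auto; [mat_red; lia | mat_red].
    f_equal; [f_equal|]; ring.
  - destruct B as [b11 b12 b13 b21 b22 b23 b31 b32 b33]; revert h2; mat_red; intros h2.
    transitivity ((a*d-b*c)*(c*b21+d*b31)); [ring | rewrite h2; ring]. }
clear B hB; destruct H as [B [hB h31]].
(* The index of [e1] is [p^2 q], so anisotropy makes both subdiagonal entries nonzero. *)
assert (hn : a21 B <> 0 /\ a32 B <> 0).
{ assert (hi : iform B e1 <> 0).
  { apply iform_neq0; [now apply (sim_isCS A) | discriminate]. }
  destruct B as [b11 b12 b13 b21 b22 b23 b31 b32 b33]; cbn in h31; subst b31.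
  revert hi; mat_red; intros hi; split; intros ->; apply hi; ring. }
assert (H : exists B, (sim A B /\ minimal B) /\ a31 B = 0 /\ 0 < a21 B /\ 0 < a32 B).
{ assert (hs : forall m, m <> 0 -> exists k, k * k = 1 /\ 0 < k * m).
  { intros m hm; destruct (Z_lt_le_dec 0 m); [exists 1 | exists (-1)]; lia. }
  destruct hn as [hn1 hn2].
  destruct (hs _ hn1) as [x [hx px]], (hs _ hn2) as [y [hy py]].
  (* For signs [x] and [y], this diagonal matrix has determinant 1 and multiplies the two
     subdiagonal entries by [x] and [y]. *)
  exists (mat_mul (mat_mul (Mat y 0 0 0 (x*y) 0 0 0 x) B) (adj (Mat y 0 0 0 (x*y) 0 0 0 x))).
  split.
  - apply (conj_minimal _ y); auto; [mat_red; nia | mat_red].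
    f_equal; [f_equal|]; ring.
  - destruct B as [b11 b12 b13 b21 b22 b23 b31 b32 b33].
    revert h31 px py; mat_red; intros -> px py; split; [ring|split].
    + match goal with |- 0 < ?e => replace e with ((x*x)*(y*y)*(x*b21)) by ring end.
      rewrite hx, hy; lia.
    + match goal with |- 0 < ?e => replace e with ((x*x)*(y*b32)) by ring end.
      rewrite hx; lia. }
clear B hB h31 hn; destruct H as [B [hB [h31 [hp hq]]]].
destruct B as [r s a p t b z q u]; cbn in h31, hp, hq; subst z.
(* Three shears fixing [e1] reduce in turn [r] modulo [p], [u] modulo [q] and [b] modulo [p], each
   preserving what was achieved before. *)
apply (conj_minimal (Mat 1 (-(r/p)) 0 0 1 0 0 0 1) 1 A _
  ltac:(mat_red; ring) ltac:(vec_ring) eq_refl) in hB.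
revert hB; mat_red; intros hB.
match type of hB with sim _ (Mat ?r' ?s' ?a' ?p' ?t' ?b' ?z' ?q' ?u') /\ _ =>
  replace p' with p in hB by ring; replace q' with q in hB by ring;
  replace z' with 0 in hB by ring;
  replace r' with (r mod p) in hB by (rewrite (Zmod_eq_full r p); lia);
  revert hB; generalize s' a' t' b' u'; clear s a t b u; intros s a t b u hB end.
generalize (Z.mod_pos_bound r p hp) hB; clear hB; generalize (r mod p); clear r.
intros r hr hB.
apply (conj_minimal (Mat 1 0 0 0 1 (u/q) 0 0 1) 1 A _
  ltac:(mat_red; ring) ltac:(vec_ring) eq_refl) in hB.
revert hB; mat_red; intros hB.
match type of hB with sim _ (Mat ?r' ?s' ?a' ?p' ?t' ?b' ?z' ?q' ?u') /\ _ =>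
  replace p' with p in hB by ring; replace q' with q in hB by ring;
  replace z' with 0 in hB by ring; replace r' with r in hB by ring;
  replace u' with (u mod q) in hB by (rewrite (Zmod_eq_full u q); lia);
  revert hB; generalize s' a' t' b'; clear s a t b; intros s a t b hB end.
generalize (Z.mod_pos_bound u q hq) hB; clear hB; generalize (u mod q); clear u.
intros u hu hB.
apply (conj_minimal (Mat 1 0 (b/p) 0 1 0 0 0 1) 1 A _
  ltac:(mat_red; ring) ltac:(vec_ring) eq_refl) in hB.
revert hB; mat_red; intros hB.
match type of hB with sim _ (Mat ?r' ?s' ?a' ?p' ?t' ?b' ?z' ?q' ?u') /\ _ =>
  replace p' with p in hB by ring; replace q' with q in hB by ring;
  replace z' with 0 in hB by ring; replace r' with r in hB by ring;
  replace u' with u in hB by ring;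
  replace b' with (b mod p) in hB by (rewrite (Zmod_eq_full b p); lia);
  revert hB; generalize s' a' t'; clear s a t; intros s a t hB end.
generalize (Z.mod_pos_bound b p hp); intros hb.
exists r, s, a, p, t, (b mod p), q, u; auto 10.
Qed.

Definition charpoly (n x : Z) : Z := x*x*x - n*(x*x) + (n-1)*x - 1.

(** Trace, sum of principal 2x2 minors and determinant; the condition on [det (A - I)] makes the
    middle one [n - 1]. *)
Lemma hessenberg_char r s a p t b q u n :
  isCS (Mat r s a p t b 0 q u) -> tr (Mat r s a p t b 0 q u) = n ->
  n = r + t + u /\ n - 1 = r*t - p*s + r*u + t*u - b*q /\
  1 = r*(t*u-b*q) - s*p*u + a*p*q.
Proof. unfold isCS; mat_red; lia. Qed.

(** Modulo [p] the first column is [r] times the first basis vector, and modulo [q] the last row is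
    [u] times the last one, so [r] and [u] are eigenvalues there. *)
Lemma hessenberg_roots r s a p t b q u n :
  isCS (Mat r s a p t b 0 q u) -> tr (Mat r s a p t b 0 q u) = n ->
  (p | charpoly n r) /\ (q | charpoly n u).
Proof.
intros hA hn; destruct (hessenberg_char _ _ _ _ _ _ _ _ _ hA hn) as [h1 [h2 h3]].
generalize (f_equal (fun x => x*(r*r)) h1) (f_equal (fun x => x*r) h2).
generalize (f_equal (fun x => x*(u*u)) h1) (f_equal (fun x => x*u) h2).
cbv beta; unfold charpoly; intros g1 g2 g3 g4; split.
- exists (-s*(r-u)-a*q); lia.
- exists (-(u-r)*b-a*p); lia.
Qed.

(** * The minimal index in the totally real case *)

(* The norm of [a + b t + c t^2], where [t] is a root of [x^3 - s1 x^2 + s2 x - s3]. *)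
Definition cubic_norm (s1 s2 s3 a b c : Z) : Z :=
  a*a*a + b*b*b*s3 + c*c*c*(s3*s3) + a*a*b*s1 + a*a*c*(s1*s1-2*s2) + a*b*b*s2
  + a*c*c*(s2*s2-2*s1*s3) + b*b*c*(s1*s3) + b*c*c*(s2*s3) + a*b*c*(s1*s2-3*s3).

(* With [e1] identified with 1, [p*q*(x,y,z)] is the polynomial in [A] whose
   coefficients are the last three arguments of [cubic_norm]. *)
Lemma iform_hessenberg r s a p t b q u n x y z :
  isCS (Mat r s a p t b 0 q u) -> tr (Mat r s a p t b 0 q u) = n ->
  (p*q)*(p*q)*(p*q) * iform (Mat r s a p t b 0 q u) (x, y, z) =
  p*p*q * cubic_norm n (n-1) 1 (p*q*x - q*r*y + (r*t-s*p)*z) (q*y-(r+t)*z) z.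
Proof.
intros hA hn; destruct (hessenberg_char _ _ _ _ _ _ _ _ _ hA hn) as [h1 [h2 h3]].
assert (h : forall s1 s2 s3,
  s1 = r + t + u -> s2 = r*t - p*s + r*u + t*u - b*q -> s3 = r*(t*u-b*q) - s*p*u + a*p*q ->
  (p*q)*(p*q)*(p*q) * iform (Mat r s a p t b 0 q u) (x, y, z) =
  p*p*q * cubic_norm s1 s2 s3 (p*q*x - q*r*y + (r*t-s*p)*z) (q*y-(r+t)*z) z).
{ intros ? ? ? -> -> ->; unfold cubic_norm; mat_red; ring. }
now apply h.
Qed.

Section RealRoots.
Local Open Scope R_scope.

(** After a translation the middle root lies in [0,1), and only the values of the cubic at 0 and 1
    are used. Either two roots lie in [0,1] and the third is far away, or the outer roots lie on
    either side of this interval and the signs of both values are known. *)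
Lemma real_cubic_spread_sorted (x y z : R) :
  x <= y -> y <= z ->
  (forall k : Z, 1 <= Rabs ((IZR k - x) * (IZR k - y) * (IZR k - z))) ->
  27/2 <= (x-y)*(x-y) + (y-z)*(y-z) + (x-z)*(x-z).
Proof.
intros hxy hyz h.
destruct (archimed y) as [u1 u2]; set (k := (up y - 1)%Z).
assert (hk : IZR k <= y < IZR k + 1) by (unfold k; rewrite minus_IZR; lra).
clearbody k; clear u1 u2.
assert (h0 := h k); assert (h1 := h (k + 1)%Z); rewrite plus_IZR in h1.
clear h; revert h0 h1 hk; generalize (IZR k); clear k; intros k h0 h1 hk.
set (a := x - k); set (b := y - k); set (c := z - k).
replace (x - y) with (a - b) by (unfold a, b; ring).
replace (x - z) with (a - c) by (unfold a, c; ring).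
replace (y - z) with (b - c) by (unfold b, c; ring).
replace ((k-x)*(k-y)*(k-z)) with (-(a*b*c)) in h0 by (unfold a, b, c; ring).
replace ((k+1-x)*(k+1-y)*(k+1-z)) with ((1-a)*(1-b)*(1-c)) in h1 by (unfold a, b, c; ring).
assert (hab : a <= b) by (unfold a, b; lra); assert (hbc : b <= c) by (unfold b, c; lra).
assert (hb : 0 <= b < 1) by (unfold b; lra).
clearbody a b c; clear hxy hyz hk x y z k.
assert (hprod : 1 <= Rabs ((a*(1-a))*(b*(1-b))*(c*(1-c)))).
{ replace ((a*(1-a))*(b*(1-b))*(c*(1-c))) with (-(-(a*b*c)*((1-a)*(1-b)*(1-c)))) by ring.
  rewrite Rabs_Ropp, Rabs_mult.
  apply (Rle_trans _ (1*1)); [lra | apply Rmult_le_compat; lra]. }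
(* Two roots in [0,1] contribute at most 1/16 to [hprod], so the third root [t] satisfies
   [|t(1-t)| >= 16]; this gives the bounds 4.5 and -3.5 below. *)
assert (hq : forall t : R, t*(1-t) <= 1/4).
{ intros t; assert (hs := Rle_0_sqr (t-1/2)); unfold Rsqr in hs; lra. }
destruct (Rle_lt_dec 0 a) as [ha|ha].
- assert (hA := hq a); assert (hB := hq b).
  assert (0 <= a*(1-a)) by nra; assert (0 <= b*(1-b)) by nra.
  assert (h16 : 0 <= a*(1-a)*(b*(1-b)) <= 1/16) by nra.
  rewrite Rabs_mult, (Rabs_pos_eq (a*(1-a)*(b*(1-b)))) in hprod by lra.
  assert (hc : 16 <= Rabs (c*(1-c))) by (assert (0 <= Rabs (c*(1-c))) by apply Rabs_pos; nra).
  assert (4.5 <= c).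
  { destruct (Rle_lt_dec 4.5 c); auto; exfalso; revert hc; unfold Rabs.
    destruct (Rcase_abs (c*(1-c))); nra. }
  nra.
- destruct (Rle_lt_dec c 1) as [hc|hc].
  + assert (hC := hq c); assert (hB := hq b).
    assert (0 <= c*(1-c)) by nra; assert (0 <= b*(1-b)) by nra.
    assert (h16 : 0 <= b*(1-b)*(c*(1-c)) <= 1/16) by nra.
    rewrite Rmult_assoc, Rabs_mult, (Rabs_pos_eq (b*(1-b)*(c*(1-c)))) in hprod by lra.
    assert (ha' : 16 <= Rabs (a*(1-a))) by (assert (0 <= Rabs (a*(1-a))) by apply Rabs_pos; nra).
    assert (a <= -3.5).
    { destruct (Rle_lt_dec a (-3.5)); auto; exfalso; revert ha'; unfold Rabs.
      destruct (Rcase_abs (a*(1-a))); nra. }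
    nra.
  + assert (h0' : a*b*c <= -1).
    { assert (hp : 0 <= (-a)*(b*c)) by (repeat apply Rmult_le_pos; lra).
      revert h0; unfold Rabs; destruct (Rcase_abs (-(a*b*c))); lra. }
    assert (h1' : (1-a)*(1-b)*(1-c) <= -1).
    { assert (hp : 0 <= (1-a)*(1-b)*(c-1)) by (repeat apply Rmult_le_pos; lra).
      revert h1; unfold Rabs; destruct (Rcase_abs ((1-a)*(1-b)*(1-c))); lra. }
    (* With [s1], [s2] the elementary symmetric functions of the roots, adding [h0'] and [h1'] gives
       [s2 <= s1 - 3], so the spread [2 s1^2 - 6 s2] is at least [2 (s1 - 3/2)^2 + 27/2]. *)
    assert (hs := Rle_0_sqr (a+b+c-3/2)); unfold Rsqr in hs; lra.
Qed.

Lemma real_cubic_spread (x y z : R) :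
  (forall k : Z, 1 <= Rabs ((IZR k - x) * (IZR k - y) * (IZR k - z))) ->
  27/2 <= (x-y)*(x-y) + (y-z)*(y-z) + (x-z)*(x-z).
Proof.
intros h.
assert (H : forall x y z : R, x <= y -> y <= z ->
  (forall k : Z, 1 <= Rabs ((IZR k - x) * (IZR k - y) * (IZR k - z))) ->
  27 <= 2*((x-y)*(x-y) + (y-z)*(y-z) + (x-z)*(x-z))).
{ intros a b c hab hbc habc; generalize (real_cubic_spread_sorted a b c hab hbc habc); lra. }
destruct (Rle_lt_dec x y), (Rle_lt_dec y z), (Rle_lt_dec x z);
  [ generalize (H x y z) | generalize (H x y z) | generalize (H x z y)
  | generalize (H z x y) | generalize (H y x z) | generalize (H y z x)
  | generalize (H z y x) | generalize (H z y x) ];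
  intros G; (match type of G with _ -> _ -> ?h' -> _ => assert (hh : h') end;
    [ intros k; generalize (h k); intros hk; eapply Rle_trans; [exact hk|];
      apply Req_le; f_equal; ring
    | assert (G' := G ltac:(lra) ltac:(lra) hh); lra ]).
Qed.
End RealRoots.

(** Gauss reduction, by induction on the leading coefficient: [b] is brought into [[-a, a)] and the
    outer coefficients are swapped if the last is smaller. For a reduced form [b^2 <= a^2 <= a c],
    so the value [a] at [(1, 0)] satisfies the bound. *)
Lemma binary_form_minimum (a b c : Z) :
  0 < a -> 0 < 4*a*c - b*b ->
  exists y z, ~ (y = 0 /\ z = 0) /\
    3 * ((a*y*y + b*y*z + c*z*z) * (a*y*y + b*y*z + c*z*z)) <= 4*a*c - b*b.
Proof.
intros ha; revert b c; revert a ha.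
refine (well_founded_ind (Z.lt_wf 0) _ _); intros a IH ha b c hD.
set (k := - ((b + a) / (2*a))).
assert (hk : -a <= b + 2*a*k < a).
{ unfold k; generalize (Z.div_mod (b+a) (2*a)) (Z.mod_pos_bound (b+a) (2*a)); lia. }
clearbody k; set (b' := b + 2*a*k) in *; set (c' := c + b*k + a*k*k).
assert (hD' : 4*a*c' - b'*b' = 4*a*c - b*b) by (unfold b', c'; ring).
assert (hc' : 0 < c') by nia.
destruct (Z_lt_le_dec c' a) as [hlt|hle].
- destruct (IH c' ltac:(lia) hc' b' a) as [y [z [hyz hv]]].
  { lia. }
  exists (z + k*y), y; split; [nia|].
  replace (a*(z+k*y)*(z+k*y) + b*(z+k*y)*y + c*y*y) with (c'*y*y + b'*y*z + a*z*z)
    by (unfold b', c'; ring).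
  lia.
- exists 1, 0; split; [lia|].
  rewrite <- hD'; clearbody b' c'.
  replace (a*1*1 + b*1*0 + c*0*0) with a by ring.
  assert (b'*b' <= a*a) by nia; nia.
Qed.

Section RealRoots.
Local Open Scope R_scope.

Lemma charpoly_real_roots (n : Z) : (6 <= n \/ n <= -1)%Z ->
  exists x y z : R, x + y + z = IZR n /\ x*y + y*z + x*z = IZR (n-1) /\ x*y*z = 1.
Proof.
intros hn; set (N := IZR n); set (f := fun x : R => x*x*x - N*(x*x) + (N-1)*x - 1).
assert (hf : continuity f) by (unfold f; reg).
assert (H : exists a b c d : R, (a < b < c /\ c < d) /\ f a < 0 /\ 0 < f b /\ f c < 0 /\ 0 < f d).
{ destruct hn as [hn|hn]; apply IZR_le in hn; fold N in hn.
  - exists 0, (1/2), 1, N; unfold f; repeat split; try lra; nra.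
  - exists (N-1), (-1), 0, 3; unfold f; repeat split; try lra; nra. }
destruct H as [a [b [c [d [[hab hcd] [fa [fb [fc fd]]]]]]]].
destruct (IVT_cor f a b hf) as [x [hx fx]]; [lra | nra |].
destruct (IVT_cor f b c hf) as [y [hy fy]]; [lra | nra |].
destruct (IVT_cor f c d hf) as [z [hz fz]]; [lra | nra |].
assert (hxy : x - y <> 0) by (intros e; assert (x = b) by lra; subst x; lra).
assert (hyz : y - z <> 0) by (intros e; assert (y = c) by lra; subst y; lra).
assert (hxz : x - z <> 0) by (intros e; assert (x = b) by lra; subst x; lra).
exists x, y, z; rewrite minus_IZR; fold N; unfold f in *; clearbody N.
(* Vieta's formulas by divided differences of the three equations, the roots being distinct. *)
assert (q1 : x*x + x*y + y*y - N*(x+y) + (N-1) = 0).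
{ apply (Rmult_eq_reg_l (x-y)); auto; lra. }
assert (q2 : y*y + y*z + z*z - N*(y+z) + (N-1) = 0).
{ apply (Rmult_eq_reg_l (y-z)); auto; lra. }
assert (q3 : x + y + z = N).
{ apply (Rmult_eq_reg_l (x-z)); auto; lra. }
assert (q4 : x*y + y*z + x*z = N - 1) by (rewrite <- q3 in q1 |- *; lra).
repeat split; auto; rewrite <- q4, <- q3 in fx; lra.
Qed.
End RealRoots.

(* The form [B -> 3 tr (B^2) - (tr B)^2] at [B = b A + c A^2], halved, for [A] with
   characteristic polynomial [x^3 - s1 x^2 + s2 x - s3]; its discriminant is -3 times
   that of this polynomial. *)
Definition trace_form (s1 s2 s3 b c : Z) : Z :=
  (s1*s1 - 3*s2)*(b*b) + (2*s1*s1*s1 - 7*s1*s2 + 9*s3)*(b*c)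
  + (s1*s1*s1*s1 - 4*s1*s1*s2 + s2*s2 + 6*s1*s3)*(c*c).

(** The discriminant of [charpoly n]. It is invariant under [n -> 5 - n], negative for [n] from 0 to
    5 and positive for all other integers. *)
Definition disc (n : Z) : Z := n*(n-2)*(n-3)*(n-5) - 23.

Lemma IZR_cubic_norm s1 s2 s3 a b c (x y z : R) :
  (x + y + z = IZR s1 -> x*y + y*z + x*z = IZR s2 -> x*y*z = IZR s3 ->
  IZR (cubic_norm s1 s2 s3 a b c) =
  (IZR a + IZR b*x + IZR c*(x*x)) * (IZR a + IZR b*y + IZR c*(y*y))
  * (IZR a + IZR b*z + IZR c*(z*z)))%R.
Proof.
intros h1 h2 h3; unfold cubic_norm.
repeat (rewrite plus_IZR || rewrite minus_IZR || rewrite mult_IZR).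
rewrite <- h1, <- h2, <- h3; ring.
Qed.

(** Twice the trace form is the sum of the squared differences of the conjugates of
    [b t + c t^2]. *)
Lemma IZR_trace_form s1 s2 s3 b c (x y z : R) :
  (x + y + z = IZR s1 -> x*y + y*z + x*z = IZR s2 -> x*y*z = IZR s3 ->
  2 * IZR (trace_form s1 s2 s3 b c) =
  (x-y)*(x-y)*((IZR b + IZR c*(x+y))*(IZR b + IZR c*(x+y)))
  + (y-z)*(y-z)*((IZR b + IZR c*(y+z))*(IZR b + IZR c*(y+z)))
  + (x-z)*(x-z)*((IZR b + IZR c*(x+z))*(IZR b + IZR c*(x+z))))%R.
Proof.
intros h1 h2 h3; unfold trace_form.
repeat (rewrite plus_IZR || rewrite minus_IZR || rewrite mult_IZR).
rewrite <- h1, <- h2, <- h3; ring.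
Qed.

(** For fixed [(y, z)], the index form divided by [p^2 q] is a monic cubic in [x] with three real
    roots, and minimality makes it at least 1 in absolute value at every integer. The spread of its
    roots, which is a value of the trace form up to scaling, is thus bounded below. Comparison with
    the minimum of that binary form gives the result. *)
Lemma hessenberg_bound r s a p t b q u n :
  let H := Mat r s a p t b 0 q u in
  (6 <= n \/ n <= -1) -> isCS H -> tr H = n -> minimal H -> 0 < p -> 0 < q ->
  729 * ((p*p*q)*(p*p*q)) <= 16 * disc n.
Proof.
intros H hn hA ht hmin hp hq.
assert (hpq : 0 < p*q) by nia.
assert (he : iform H e1 = p*p*q) by (unfold H; mat_red; ring).
assert (hF : forall y z, ~ (y = 0 /\ z = 0) ->
  27 * ((p*q)*(p*q)) <= 4 * trace_form n (n-1) 1 (q*y-(r+t)*z) z).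
{ intros y z hyz.
  destruct (charpoly_real_roots n hn) as [x1 [x2 [x3 [h1 [h2 h3]]]]].
  set (be := q*y-(r+t)*z); set (al := -(q*r*y) + (r*t-s*p)*z).
  (* The roots of the cubic in the first coordinate, one for each eigenvalue. *)
  set (rho := fun x => (-((IZR al + IZR be*x + IZR z*(x*x)) / IZR (p*q)))%R).
  assert (hR : (0 < IZR (p*q))%R) by now apply IZR_lt.
  assert (hg := real_cubic_spread (rho x1) (rho x2) (rho x3)).
  assert (hk : (27/2 * (IZR (p*q) * IZR (p*q)) <= 2 * IZR (trace_form n (n-1) 1 be z))%R).
  { rewrite (IZR_trace_form _ _ _ _ _ x1 x2 x3 h1 h2 h3).
    match goal with |- (_ <= ?e)%R =>
      replace e with
        (((rho x1 - rho x2)*(rho x1 - rho x2) + (rho x2 - rho x3)*(rho x2 - rho x3)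
          + (rho x1 - rho x3)*(rho x1 - rho x3)) * (IZR (p*q) * IZR (p*q)))%R
        by (unfold rho; field; lra) end.
    apply Rmult_le_compat_r; [nra|]; apply hg; intros k.
    assert (hv : (k, y, z) <> vzero) by (intros e; apply hyz; now inversion e).
    assert (hm := hmin _ hv); rewrite he in hm.
    assert (hi := iform_hessenberg r s a p t b q u n k y z hA ht); fold H in hi.
    replace (p*q*k - q*r*y + (r*t-s*p)*z) with (p*q*k + al) in hi by (unfold al; ring).
    fold be in hi; apply (f_equal IZR) in hi.
    rewrite (mult_IZR (p*p*q)), (IZR_cubic_norm _ _ _ _ _ _ x1 x2 x3 h1 h2 h3) in hi.
    rewrite plus_IZR, (mult_IZR (p*q) k) in hi.
    rewrite !(mult_IZR _ (iform H _)), !(mult_IZR _ (p*q)) in hi.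
    assert (hM : (0 < IZR (p*p*q))%R) by (apply IZR_lt; nia).
    apply IZR_le in hm; rewrite !abs_IZR, (Rabs_pos_eq (IZR (p*p*q))) in hm by lra.
    match goal with |- (_ <= Rabs ?e)%R =>
      replace e with (IZR (iform H (k, y, z)) / IZR (p*p*q))%R end.
    - unfold Rdiv; rewrite Rabs_mult, (Rabs_pos_eq (/ _)).
      + apply (Rmult_le_reg_r (IZR (p*p*q))); auto; rewrite Rmult_assoc, Rinv_l; lra.
      + now apply Rlt_le, Rinv_0_lt_compat.
    - assert (hR3 : (IZR (p*q) * IZR (p*q) * IZR (p*q) <> 0)%R).
      { repeat apply Rmult_integral_contrapositive_currified; lra. }
      apply (Rmult_eq_reg_l (IZR (p*p*q) * (IZR (p*q) * IZR (p*q) * IZR (p*q)))).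
      2: { apply Rmult_integral_contrapositive_currified; auto; lra. }
      transitivity (IZR (p*q) * IZR (p*q) * IZR (p*q) * IZR (iform H (k, y, z)))%R;
        [field; lra|].
      rewrite hi; unfold rho; field; lra. }
  apply le_IZR; rewrite !mult_IZR in *; lra. }
set (k := r + t) in *.
(* The coefficients of the trace form at [(q y - k z, z)]; the quantity [4 a c - b^2] of this form
   in [(y, z)] is [3 q^2 disc n]. *)
destruct (binary_form_minimum ((n*n-3*(n-1))*(q*q))
  (q*((2*n*n*n-7*n*(n-1)+9) - 2*(n*n-3*(n-1))*k))
  ((n*n-3*(n-1))*(k*k) - (2*n*n*n-7*n*(n-1)+9)*k + (n*n*n*n-4*n*n*(n-1)+(n-1)*(n-1)+6*n)))
  as [y [z [hyz hv]]].
- nia.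
- match goal with |- 0 < ?e => replace e with (3*disc n*(q*q)) by (unfold disc; ring) end.
  assert (0 < disc n) by (unfold disc; nia); nia.
- match type of hv with _ <= ?e => replace e with (3*disc n*(q*q)) in hv by (unfold disc; ring) end.
  specialize (hF y z hyz).
  match type of hv with 3 * (?e * _) <= _ =>
    replace e with (trace_form n (n-1) 1 (q*y-k*z) z) in hv by (unfold trace_form; ring) end.
  revert hF hv; generalize (trace_form n (n-1) 1 (q*y-k*z) z); intros v h1 h2.
  assert (h3 : (27*((p*q)*(p*q)))*(27*((p*q)*(p*q))) <= 16*(v*v)) by nia.
  apply (Z.mul_le_mono_pos_r _ _ (q*q)); nia.
Qed.

(** * The minimal index for traces 0 to 5 *)

(** Coordinates are measured in twentieths of [M], whence [8000 = 20^3]; this keeps the estimates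
    linear in the monomials. *)
Lemma monomial_bound M x y z i j k :
  20 * Z.abs x <= i * M -> 20 * Z.abs y <= j * M -> 20 * Z.abs z <= k * M ->
  - (i*j*k * (M*M*M)) <= 8000 * (x*y*z) <= i*j*k * (M*M*M).
Proof.
intros hx hy hz; enough (8000 * Z.abs (x*y*z) <= i*j*k * (M*M*M)) by lia.
rewrite !Z.abs_mul.
replace (i*j*k*(M*M*M)) with ((i*M)*(j*M)*(k*M)) by ring.
replace (8000*(Z.abs x*Z.abs y*Z.abs z)) with
  ((20*Z.abs x)*(20*Z.abs y)*(20*Z.abs z)) by ring.
apply Z.mul_le_mono_nonneg; [nia | | lia | lia].
apply Z.mul_le_mono_nonneg; lia.
Qed.

(* Traces 0 to 5 only give two orders, Z[t] with [t^3 - s1 t^2 + s2 t - 1 = 0] for the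
   following coefficients; their discriminants are -23 and -31. *)
Definition small_form (s1 s2 : Z) : Prop := s1 = 0 /\ s2 = -1 \/ s1 = 1 /\ s2 = 0.

(** Bounding the ten monomials separately suffices on these four boxes: one coordinate at most
    [0.3 M] and the others [0.5 M], or all three at most [0.4 M]. *)
Lemma small_form_bound s1 s2 M a b c i j k :
  small_form s1 s2 -> 0 < M ->
  In (i, j, k) [(6, 10, 10); (10, 6, 10); (10, 10, 6); (8, 8, 8)] ->
  20 * Z.abs a <= i * M -> 20 * Z.abs b <= j * M -> 20 * Z.abs c <= k * M ->
  Z.abs (cubic_norm s1 s2 1 a b c) < M*M*M.
Proof.
intros hs hM hijk ha hb hc.
generalize (monomial_bound M _ _ _ _ _ _ ha ha ha) (monomial_bound M _ _ _ _ _ _ hb hb hb)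
  (monomial_bound M _ _ _ _ _ _ hc hc hc) (monomial_bound M _ _ _ _ _ _ ha ha hb)
  (monomial_bound M _ _ _ _ _ _ ha ha hc) (monomial_bound M _ _ _ _ _ _ ha hb hb)
  (monomial_bound M _ _ _ _ _ _ ha hc hc) (monomial_bound M _ _ _ _ _ _ hb hb hc)
  (monomial_bound M _ _ _ _ _ _ hb hc hc) (monomial_bound M _ _ _ _ _ _ ha hb hc).
assert (0 < M*M*M) by nia.
unfold cubic_norm; clear ha hb hc; rewrite Z.abs_lt.
generalize (a*a*a) (b*b*b) (c*c*c) (a*a*b) (a*a*c) (a*b*b) (a*c*c) (b*b*c) (b*c*c) (a*b*c).
intros; destruct hs as [[-> ->]|[-> ->]];
  repeat (destruct hijk as [hijk|hijk]; [injection hijk as <- <- <-; lia|]); destruct hijk.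
Qed.

Lemma centered_mod M x : 0 < M -> exists k, 2 * Z.abs (x + M*k) <= M.
Proof.
intros hM; exists (- ((2*x + M) / (2*M))).
generalize (Z.div_mod (2*x+M) (2*M)) (Z.mod_pos_bound (2*x+M) (2*M)); lia.
Qed.

(* A Euclidean division up to doubling: norms are below 1 on the cube of points with
   centered coordinates, except possibly near its vertices, whose doubles are close to
   lattice points. *)
Lemma small_form_euclid s1 s2 M a b c :
  small_form s1 s2 -> 0 < M -> exists k x y z, (k = 1 \/ k = 2) /\
    Z.abs (cubic_norm s1 s2 1 (k*a+M*x) (k*b+M*y) (k*c+M*z)) < M*M*M.
Proof.
intros hs hM.
destruct (centered_mod M a hM) as [x hx], (centered_mod M b hM) as [y hy],
  (centered_mod M c hM) as [z hz].
destruct (Z_le_gt_dec (20 * Z.abs (a+M*x)) (6*M)) as [h1|h1].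
{ exists 1, x, y, z; split; [auto|].
  apply (small_form_bound _ _ _ _ _ _ 6 10 10); [auto|auto|simpl; auto|lia|lia|lia]. }
destruct (Z_le_gt_dec (20 * Z.abs (b+M*y)) (6*M)) as [h2|h2].
{ exists 1, x, y, z; split; [auto|].
  apply (small_form_bound _ _ _ _ _ _ 10 6 10); [auto|auto|simpl; auto|lia|lia|lia]. }
destruct (Z_le_gt_dec (20 * Z.abs (c+M*z)) (6*M)) as [h3|h3].
{ exists 1, x, y, z; split; [auto|].
  apply (small_form_bound _ _ _ _ _ _ 10 10 6); [auto|auto|simpl; auto|lia|lia|lia]. }
(* All centered coordinates now lie between [0.3 M] and [0.5 M] in absolute value, so their doubles
   are within [0.4 M] of [M] or [-M]. *)
exists 2, (2*x - Z.sgn (a+M*x)), (2*y - Z.sgn (b+M*y)), (2*z - Z.sgn (c+M*z)).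
split; [auto|].
assert (hd : forall t u, 2 * Z.abs (t+M*u) <= M -> 20 * Z.abs (t+M*u) > 6*M ->
  20 * Z.abs (2*t + M*(2*u - Z.sgn (t+M*u))) <= 8*M).
{ intros t u.
  replace (2*t + M*(2*u - Z.sgn (t+M*u))) with (2*(t+M*u) - M*Z.sgn (t+M*u)) by ring.
  generalize (t+M*u); intros w hw1 hw2; destruct (Z.lt_trichotomy w 0) as [h|[h|h]].
  - rewrite (Z.sgn_neg _ h); lia.
  - lia.
  - rewrite (Z.sgn_pos _ h); lia. }
apply (small_form_bound _ _ _ _ _ _ 8 8 8); auto; simpl; auto.
Qed.

(** An isomorphism with one of the two orders: the columns of [U] express 1, [t], [t^2] in the
    powers of a root of [charpoly n]. *)
Lemma cubic_norm_small n : 0 <= n <= 5 ->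
  exists s1 s2 U V, small_form s1 s2 /\ mat_mul U V = one /\
    forall a b c, let '(a', b', c') := app U (a, b, c) in
      cubic_norm n (n-1) 1 a' b' c' = cubic_norm s1 s2 1 a b c.
Proof.
intros hn; unfold small_form.
assert (H : n = 0 \/ n = 1 \/ n = 2 \/ n = 3 \/ n = 4 \/ n = 5) by lia.
destruct H as [-> | [-> | [-> | [-> | [-> | ->]]]]].
- exists 0, (-1), one, one; split; [lia|split; [reflexivity|]].
  intros; cbn [app one]; unfold cubic_norm; ring.
- exists 1, 0, one, one; split; [lia|split; [reflexivity|]].
  intros; cbn [app one]; unfold cubic_norm; ring.
- exists 0, (-1), (Mat 1 0 0 0 (-1) 1 0 1 0), (Mat 1 0 0 0 0 1 0 1 1).
  split; [lia|split; [reflexivity|]]; intros; cbn [app]; unfold cubic_norm; ring.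
- exists 0, (-1), (Mat 1 (-1) 1 0 1 (-2) 0 0 1), (Mat 1 1 1 0 1 2 0 0 1).
  split; [lia|split; [reflexivity|]]; intros; cbn [app]; unfold cubic_norm; ring.
- exists 1, 0, (Mat 1 1 (-1) 0 (-3) 1 0 1 0), (Mat 1 1 2 0 0 1 0 1 3).
  split; [lia|split; [reflexivity|]]; intros; cbn [app]; unfold cubic_norm; ring.
- exists 0, (-1), (Mat 1 1 (-2) 0 (-4) 5 0 1 (-1)), (Mat 1 1 3 0 1 5 0 1 4).
  split; [lia|split; [reflexivity|]]; intros; cbn [app]; unfold cubic_norm; ring.
Qed.

(** With [e1] identified with 1, the vector [M e3] is [al + be t + t^2]. If [M > 2], Euclidean
    division of it, or of its double, by [M] yields a nonzero vector of smaller index than [e1]. *)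
Lemma hessenberg_small r s a p t b q u n :
  let H := Mat r s a p t b 0 q u in
  0 <= n <= 5 -> isCS H -> tr H = n -> minimal H -> 0 < p -> 0 < q -> p = 1 /\ q = 1.
Proof.
intros H hn hA ht hmin hp hq.
assert (he : iform H e1 = p*p*q) by (unfold H; mat_red; ring).
(* The index [p^2 q] is odd, which excludes [p q = 2]. *)
enough (~ 2 < p*q).
{ assert (ho := iform_odd H 1 0 0 hA eq_refl); fold e1 in ho; rewrite he, !Z.odd_mul in ho.
  assert (p*q <> 2).
  { intros e; apply (f_equal Z.odd) in e; rewrite Z.odd_mul in e.
    destruct (Z.odd p), (Z.odd q); discriminate. }
  nia. }
intros hM; set (M := p*q) in *.
destruct (cubic_norm_small n hn) as [s1 [s2 [U [V [hs [hUV hU]]]]]].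
set (al := r*t-s*p); set (be := -(r+t)).
destruct (app V (al, be, 1)) as [[a0 b0] c0] eqn:hV.
destruct (small_form_euclid s1 s2 M a0 b0 c0 hs ltac:(lia))
  as [k [x [y [z [hk hlt]]]]].
assert (hX : exists X Y Z, app U (k*a0+M*x, k*b0+M*y, k*c0+M*z)
  = (k*al+M*X, k*be+M*Y, k+M*Z)).
{ destruct (app U (x, y, z)) as [[X Y] Z] eqn:hx; exists X, Y, Z.
  assert (h0 : app U (a0, b0, c0) = (al, be, 1)).
  { now rewrite <- hV, <- app_mul, hUV, app_one. }
  clearbody al be; revert h0 hx; clear; destruct U; cbn [app]; intros h0 hx.
  injection h0 as h1 h2 h3; injection hx as <- <- <-.
  rewrite <- h1, <- h2; apply f_equal2; [apply f_equal2; ring|].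
  rewrite <- (Z.mul_1_r k) at 4; rewrite <- h3; ring. }
destruct hX as [X [Y [Z hX]]].
generalize (hU (k*a0+M*x) (k*b0+M*y) (k*c0+M*z)); rewrite hX; intros hU'.
rewrite <- hU' in hlt; clear hU hU'.
(* This is [k e3 + X e1 + Y A e1 + Z A^2 e1]; its last coordinate is nonzero because [0 < k < M]. *)
set (w := (X + r*Y + (r*(r+t) - al)*Z, p*Y + (r+t)*p*Z, k + M*Z)).
assert (hw : w <> vzero).
{ intros e; injection e as _ _ e; clearbody M; destruct (Z_le_gt_dec 0 Z); nia. }
assert (hi := iform_hessenberg r s a p t b q u n (X + r*Y + (r*(r+t) - al)*Z)
  (p*Y + (r+t)*p*Z) (k + M*Z) hA ht).
fold H w M in hi.
replace (M*(X + r*Y + (r*(r+t) - al)*Z) - q*r*(p*Y + (r+t)*p*Z) + (r*t-s*p)*(k + M*Z))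
  with (k*al+M*X) in hi by (unfold al, M; ring).
replace (q*(p*Y + (r+t)*p*Z) - (r+t)*(k + M*Z)) with (k*be+M*Y) in hi by (unfold be, M; ring).
generalize (hmin w hw); rewrite he; intros hle.
assert (h1 : 0 < p*p*q) by (repeat apply Z.mul_pos_pos; lia).
assert (h2 : 0 < M*M*M) by (repeat apply Z.mul_pos_pos; lia).
apply (f_equal Z.abs) in hi; rewrite !(Z.abs_mul (_*_*_)) in hi.
rewrite (Z.abs_eq (M*M*M)), !(Z.abs_eq (p*p*q)) in * by lia.
revert hi hle hlt h1 h2; clear.
generalize (p*p*q) (M*M*M) (Z.abs (iform H w)); intros; nia.
Qed.

(** * Verified search *)

Definition std (c d n : Z) : mat :=
  Mat 0 (-(charpoly n c / d)) ((c-1)*(n-c-1)) 0 c d 1 0 (n-c).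
Definition valid (c d n : Z) : Prop := d <> 0 /\ (d | charpoly n c).

Inductive reach : Z -> Z -> Z -> Prop :=
| reach_A0 : reach 1 1 2
| reach_sim c d c' d' n :
    valid c d n -> valid c' d' n -> sim (std c d n) (std c' d' n) ->
    reach c' d' n -> reach c d n
| reach_shift c d n n' :
    valid c d n -> valid c d n' -> (d | n' - n) -> reach c d n' -> reach c d n.

Definition known (n : Z) : Prop := forall A, isCS A -> tr A = n ->
  exists c d, valid c d n /\ sim A (std c d n) /\ reach c d n.

Lemma std_isCS c d n : valid c d n -> isCS (std c d n).
Proof.
intros [hd [k hk]]; unfold isCS, std; rewrite hk, (Z_div_mult_full k d hd).
revert hk; unfold charpoly; mat_red; lia.
Qed.

Lemma std_tr c d n : tr (std c d n) = n.
Proof. unfold std; mat_red; ring. Qed.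

(** The standard form provided by [known] may be another one, but it is similar to the given one. *)
Lemma known_reach c d n : known n -> valid c d n -> reach c d n.
Proof.
intros hn hv.
destruct (hn _ (std_isCS c d n hv) (std_tr c d n)) as [c' [d' [hv' [hs hr]]]].
now apply (reach_sim c d c' d').
Qed.

(** Changing [n] to [n'] changes [charpoly n c] by [(n' - n)(c - c^2)]. *)
Lemma valid_shift c d n n' : valid c d n -> (d | n' - n) -> valid c d n'.
Proof.
intros [hd [k hk]] [j hj]; split; auto; exists (k - j*(c*c-c)).
rewrite Z.mul_sub_distr_r, <- hk, <- Z.mul_assoc, (Z.mul_comm (c*c-c)), Z.mul_assoc, <- hj.
unfold charpoly; ring.
Qed.

Definition mat_eqb (A B : mat) : bool :=
  let (a, b, c, d, e, f, g, h, i) := A in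
  let (a', b', c', d', e', f', g', h', i') := B in
  ((a =? a') && (b =? b') && (c =? c') && (d =? d') && (e =? e') && (f =? f')
   && (g =? g') && (h =? h') && (i =? i'))%bool.

Lemma mat_eqbP A B : mat_eqb A B = true -> A = B.
Proof.
destruct A, B; cbn; rewrite !Bool.andb_true_iff, !Z.eqb_eq.
now intros [[[[[[[[-> ->] ->] ->] ->] ->] ->] ->] ->].
Qed.

(* The [d] such that [w, u, A w] is, for a suitable [u], a basis in which [A] becomes
   [std c d n], or 0 if there is none. *)
Definition std_step (A : mat) (n : Z) (w : vec) (c : Z) : Z :=
  let w' := app A w in
  let d := - iform A w in
  let '(x, y, z) := w in
  let '(x', y', z') := w' in
  let '(x'', y'', z'') := app A w' in
  let k := (c-1)*(n-c-1) in
  (* In a standard form [A e1 = e3] and [A e3 = k e1 + d e2 + (n-c) e3]; solving for [e2] gives the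
     middle column, and determinant 1 forces [d = - iform A w]. *)
  let P := cols w ((x'' - k*x - (n-c)*x') / d, (y'' - k*y - (n-c)*y') / d,
                   (z'' - k*z - (n-c)*z') / d) w' in
  if d =? 0 then 0 else
  if charpoly n c mod d =? 0 then
    if det P =? 1 then
      if mat_eqb (mat_mul P (std c d n)) (mat_mul A P) then d else 0
    else 0
  else 0.

Lemma std_step_sound A n w c :
  std_step A n w c <> 0 ->
  valid c (std_step A n w c) n /\ sim A (std c (std_step A n w c) n).
Proof.
unfold std_step; destruct w as [[x y] z].
destruct (app A (x, y, z)) as [[x' y'] z']; destruct (app A (x', y', z')) as [[x'' y''] z''].
cbv zeta; generalize (- iform A (x, y, z)); intros d.
destruct (Z.eqb_spec d 0) as [|hd]; [easy|].
destruct (Z.eqb_spec (charpoly n c mod d) 0) as [hm|]; [|easy].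
match goal with |- context [cols ?u ?v ?w] => generalize (cols u v w); intros P end.
destruct (Z.eqb_spec (det P) 1) as [hP|]; [|easy].
destruct (mat_eqb _ _) eqn:he; [|easy]; intros _; split.
- split; [auto|]; now apply Z.mod_divide.
- apply sim_sym; exists P; split; auto; now apply mat_eqbP.
Qed.

(** * Search relative to a window of traces already treated *)

Section Search.
Variables lo hi : Z.

Definition path : Type := list (vec * Z * Z).

Fixpoint follow (A : mat) (n : Z) (l : path) : bool :=
  match l with
  | [] => false
  | (w, c, n') :: l' =>
      let d := std_step A n w c in
      if d =? 0 then false else
      if (n' - n) mod d =? 0 then
        match l' with
        | [] => ((lo <=? n') && (n' <=? hi))%bool
        | _ => follow (std c d n') n' l'
        end
      else false
  end.

Lemma follow_sound l : (forall n, lo <= n <= hi -> known n) ->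
  forall A n, follow A n l = true ->
  exists c d, valid c d n /\ sim A (std c d n) /\ reach c d n.
Proof.
intros hK; induction l as [|[[w c] n'] l IH]; intros A n; [easy|].
cbn [follow]; generalize (std_step_sound A n w c); generalize (std_step A n w c); intros d hd.
destruct (Z.eqb_spec d 0) as [|h0]; [easy|]; destruct (hd h0) as [hv hs]; clear hd.
destruct (Z.eqb_spec ((n' - n) mod d) 0) as [hm|]; [|easy].
apply Z.mod_divide in hm; auto; intros hl; exists c, d; split; auto; split; auto.
assert (hv' := valid_shift _ _ _ _ hv hm).
apply (reach_shift c d n n'); auto.
destruct l as [|e l].
- rewrite Bool.andb_true_iff, !Z.leb_le in hl; apply known_reach; auto.
- destruct (IH _ _ hl) as [c' [d' [hv2 [hs2 hr2]]]].
  now apply (reach_sim c d c' d').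
Qed.

(** Written with conditionals so that call-by-value evaluation stops early; likewise [all_from]. *)
Fixpoint has {T : Type} (f : T -> bool) (l : list T) : bool :=
  match l with [] => false | x :: l' => if f x then true else has f l' end.

Lemma hasP {T : Type} (f : T -> bool) l : has f l = true -> exists x, f x = true.
Proof.
induction l as [|x l IH]; cbn; [easy|]; destruct (f x) eqn:h; eauto.
Qed.

Fixpoint all_from (k : nat) (s x : Z) (f : Z -> bool) : bool :=
  match k with O => true | S k' => if f x then all_from k' s (x + s) f else false end.

Lemma all_fromP k s x f : all_from k s x f = true ->
  forall j, 0 <= j < Z.of_nat k -> f (x + s*j) = true.
Proof.
revert x; induction k as [|k IH]; intros x; [cbn; lia|].
cbn [all_from]; destruct (f x) eqn:hx; [|easy]; intros h j hj.
destruct (Z.eq_dec j 0) as [->|hj0]; [now rewrite Z.mul_0_r, Z.add_0_r|].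
replace (x + s*j) with (x + s + s*(j-1)) by ring; apply IH; auto; lia.
Qed.

(** Gauss reduction of [a y^2 + b y z + c z^2] with fuel [k], carrying along the basis. It only
    proposes candidates, which [is_shorter] tests. *)
Fixpoint lagrange (k : nat) (a b c y1 z1 y2 z2 : Z) : (Z * Z) * (Z * Z) :=
  match k with
  | O => ((y1, z1), (y2, z2))
  | S k' =>
      let m := (b + a) / (2*a) in
      let c' := c - m*b + m*m*a in
      let b' := b - 2*m*a in
      if c' <? a then lagrange k' c' b' a (y2 - m*y1) (z2 - m*z1) y1 z1
      else ((y1, z1), (y2 - m*y1, z2 - m*z1))
  end.

Definition is_shorter (H : mat) (m : Z) (w : vec) : bool :=
  let '(x, y, z) := w in
  if ((x =? 0) && (y =? 0) && (z =? 0))%bool then false else Z.abs (iform H w) <? m.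

(* A heuristic search for a vector of smaller index. The eigenvalues of a
   Cappell-Shaneson matrix of large trace [n] are close to 0, 1 and [n-1], so that the
   trace form is nearly hexagonal. *)
Definition shorter (n : Z) (H : mat) : bool :=
  let (r, s, a, p, t, b, _, q, u) := H in
  let m := p*p*q in
  let '((y1, z1), (y2, z2)) :=
    (* The form [Y^2 + Y z + z^2] with [Y = q y + (u-1) z], to which the trace form is nearly
       proportional. *)
    lagrange 40 (q*q) (2*q*(u-1) + q) ((u-1)*(u-1) + (u-1) + 1) 1 0 0 1 in
  has (fun yz : Z * Z => let (y, z) := yz in
    has (fun e =>
      (* The two integers next to the root of the index form in [x] that belongs to the approximate
         eigenvalue [e]. *)
      let x := - ((y*q*(e-r) + z*((e-t)*(e-r) - s*p)) / (p*q)) in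
      if is_shorter H m (x, y, z) then true else is_shorter H m (x-1, y, z)) [1; 0; n-1])
    [(y1, z1); (y2, z2); (y1-y2, z1-z2); (y1+y2, z1+z2)].

Lemma shorter_sound n r s a p t b q u :
  let H := Mat r s a p t b 0 q u in
  0 < p -> 0 < q -> minimal H -> shorter n H = true -> False.
Proof.
intros H hp hq hmin; unfold shorter, H; fold H; cbv zeta.
assert (hg : forall w, is_shorter H (p*p*q) w = true -> False).
{ intros [[x y] z]; unfold is_shorter.
  destruct ((x =? 0) && (y =? 0) && (z =? 0))%bool eqn:h0; [easy|].
  rewrite Z.ltb_lt; intros hlt.
  assert (hw : (x, y, z) <> vzero) by (intros e; injection e as -> -> ->; easy).
  assert (he : iform H e1 = p*p*q) by (unfold H; mat_red; ring).
  generalize (hmin _ hw); rewrite he; intros hle.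
  assert (0 < p*p*q) by (repeat apply Z.mul_pos_pos; lia); lia. }
destruct (lagrange _ _ _ _ _ _ _ _) as [[y1 z1] [y2 z2]]; intros h.
apply hasP in h; destruct h as [[y z] h]; apply hasP in h; destruct h as [e h].
destruct (is_shorter _ _ _) eqn:h1 in h; [exact (hg _ h1)|exact (hg _ h)].
Qed.

Variable paths : list path.

Definition settled (n : Z) (H : mat) : bool :=
  let (r, s, a, p, t, b, _, q, u) := H in
  (* For [p = 1] the vector [e1] gives a standard form with [d = -q]; [n'] is the least trace from
     [lo] on congruent to [n] modulo [q]. *)
  let n' := lo + (n - lo) mod q in
  if (if n' <=? hi then follow H n [(e1, u, n')] else false) then true
  else if shorter n H then true
  else has (follow H n) paths.

Lemma settled_sound n r s a p t b q u :
  let H := Mat r s a p t b 0 q u in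
  (forall n, lo <= n <= hi -> known n) -> 0 < p -> 0 < q -> minimal H ->
  settled n H = true -> exists c d, valid c d n /\ sim H (std c d n) /\ reach c d n.
Proof.
intros H hK hp hq hmin; unfold settled, H; fold H; cbv zeta.
match goal with |- (if ?e then _ else _) = true -> _ => destruct e eqn:h1 end.
- intros _; destruct (_ <=? _) in h1; [|easy]; exact (follow_sound _ hK _ _ h1).
- destruct (shorter n H) eqn:h2.
  + intros _; destruct (shorter_sound n _ _ _ _ _ _ _ _ hp hq hmin h2).
  + intros h; apply hasP in h; destruct h as [l h]; exact (follow_sound _ hK _ _ h).
Qed.

(** The coefficients of the characteristic polynomial determine [t], [s] and [a]; an inexact
    division means that no such matrix exists. *)
Definition settled_at (n p q r u b : Z) : bool :=
  let t := n - r - u in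
  let x := r*t + r*u + t*u - b*q - (n-1) in
  if x mod p =? 0 then
    let s := x / p in
    let y := 1 - r*(t*u - b*q) + s*p*u in
    if y mod (p*q) =? 0 then settled n (Mat r s (y / (p*q)) p t b 0 q u) else true
  else true.

Lemma settled_at_sound n r s a p t b q u :
  let H := Mat r s a p t b 0 q u in
  (forall n, lo <= n <= hi -> known n) -> isCS H -> tr H = n -> 0 < p -> 0 < q -> minimal H ->
  settled_at n p q r u b = true ->
  exists c d, valid c d n /\ sim H (std c d n) /\ reach c d n.
Proof.
intros H hK hA ht hp hq hmin.
destruct (hessenberg_char _ _ _ _ _ _ _ _ _ hA ht) as [h1 [h2 h3]].
unfold settled_at; cbv zeta.
replace (n - r - u) with t by lia.
replace (r*t + r*u + t*u - b*q - (n-1)) with (s*p) by lia.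
rewrite Z_mod_mult, Z.div_mul by lia; cbn [Z.eqb].
replace (1 - r*(t*u - b*q) + s*p*u) with (a*(p*q)) by lia.
rewrite Z_mod_mult, Z.div_mul by nia; cbn [Z.eqb].
now apply settled_sound.
Qed.

End Search.

(** * Roots of the characteristic polynomial modulo odd numbers *)

Section Roots.
Variable n : Z.

Definition addm (q x y : Z) : Z := let s := x + y in if s <? q then s else s - q.

Lemma addm_mod q x y : 0 < q -> addm q (x mod q) (y mod q) = (x + y) mod q.
Proof.
intros hq; unfold addm; rewrite Z.add_mod by lia.
generalize (Z.mod_pos_bound x q hq) (Z.mod_pos_bound y q hq).
generalize (x mod q) (y mod q); intros a b ha hb.
destruct (Z.ltb_spec (a + b) q).
- now rewrite Z.mod_small by lia.
- apply (Z.mod_unique_pos _ _ 1); lia.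
Qed.

(* [f], [d1], [d2], [d3] are the finite differences at [c] of the polynomial modulo [q]. *)
Fixpoint scan (k : nat) (q c f d1 d2 d3 : Z) : list Z :=
  match k with
  | O => []
  | S k' =>
      let l := scan k' q (c+1) (addm q f d1) (addm q d1 d2) (addm q d2 d3) d3 in
      match f with Z0 => c :: l | _ => l end
  end.

Definition diff1 (c : Z) : Z := charpoly n (c+1) - charpoly n c.
Definition diff2 (c : Z) : Z := diff1 (c+1) - diff1 c.

Lemma scan_complete k q c : 0 < q ->
  forall u, c <= u < c + Z.of_nat k -> (q | charpoly n u) ->
  In u (scan k q c (charpoly n c mod q) (diff1 c mod q) (diff2 c mod q) (6 mod q)).
Proof.
intros hq; revert c; induction k as [|k IH]; intros c u hu hd; [lia|].
cbn [scan]; rewrite !addm_mod by auto.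
replace (charpoly n c + diff1 c) with (charpoly n (c+1)) by (unfold diff1; ring).
replace (diff1 c + diff2 c) with (diff1 (c+1)) by (unfold diff2; ring).
replace (diff2 c + 6) with (diff2 (c+1)) by (unfold diff2, diff1, charpoly; ring).
destruct (Z.eq_dec u c) as [->|hne].
- rewrite (proj2 (Z.mod_divide _ q ltac:(lia)) hd); now left.
- assert (hi := IH (c+1) u ltac:(lia) hd).
  destruct (charpoly n c mod q); auto; now right.
Qed.

Fixpoint lifts (k : nat) (q q' c : Z) : list Z :=
  match k with
  | O => []
  | S k' => if charpoly n c mod q =? 0 then c :: lifts k' q q' (c + q')
            else lifts k' q q' (c + q')
  end.

Lemma lifts_complete k q q' c : 0 < q ->
  forall j, 0 <= j < Z.of_nat k -> (q | charpoly n (c + q'*j)) -> In (c + q'*j) (lifts k q q' c).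
Proof.
intros hq; revert c; induction k as [|k IH]; intros c j hj hd; [lia|]; cbn [lifts].
destruct (Z.eq_dec j 0) as [->|hj0].
- rewrite Z.mul_0_r, Z.add_0_r in *.
  rewrite (proj2 (Z.mod_divide _ q ltac:(lia)) hd); now left.
- replace (c + q'*j) with (c + q' + q'*(j-1)) in * by ring.
  assert (hi := IH (c+q') (j-1) ltac:(lia) hd).
  destruct (_ =? 0); auto; now right.
Qed.

Definition table : Type := PositiveMap.t (list Z).
Definition get (tab : table) (q : Z) : list Z :=
  match PositiveMap.find (Z.to_pos q) tab with Some l => l | None => [] end.

Definition scan_all (q : Z) : list Z :=
  scan (Z.to_nat q) q 0 (charpoly n 0 mod q) (diff1 0 mod q) (diff2 0 mod q) (6 mod q).

(** A root modulo [q] lies over one modulo [q/l], which is already in the table, so for a small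
    prime factor [l] only [l] lifts of each are tried. *)
Definition roots_mod (tab : table) (q : Z) : list Z :=
  match find (fun l => q mod l =? 0) [3; 5; 7; 11; 13] with
  | Some l => if l =? q then scan_all q else
      flat_map (lifts (Z.to_nat l) q (q/l)) (get tab (q/l))
  | None => scan_all q
  end.

Definition complete (tab : table) (Q : Z) : Prop :=
  forall q u, Z.odd q = true -> 1 <= q < Q -> 0 <= u < q -> (q | charpoly n u) ->
  In u (get tab q).

Lemma charpoly_mod q u : 0 < q -> (q | charpoly n u) -> (q | charpoly n (u mod q)).
Proof.
intros hq [k hk]; rewrite (Z.mod_eq u q) by lia; set (v := u / q).
exists (k - (3*u*u*v - 3*u*v*v*q + v*v*v*q*q - n*(2*u*v - v*v*q) + (n-1)*v)).
rewrite Z.mul_sub_distr_r, <- hk; unfold charpoly; ring.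
Qed.

Lemma scan_all_complete q u : 0 <= u < q -> (q | charpoly n u) -> In u (scan_all q).
Proof. intros hu hd; apply scan_complete; auto; lia. Qed.

Lemma roots_mod_complete tab q u :
  complete tab q -> Z.odd q = true -> 1 <= q -> 0 <= u < q -> (q | charpoly n u) ->
  In u (roots_mod tab q).
Proof.
intros ht ho hq hu hd; unfold roots_mod.
destruct (find _ _) as [l|] eqn:hf; [|now apply scan_all_complete].
destruct (Z.eqb_spec l q) as [|hl]; [now apply scan_all_complete|].
apply find_some in hf; destruct hf as [hin hm]; apply Z.eqb_eq in hm.
assert (hl3 : 3 <= l) by (cbn in hin; lia); clear hin.
assert (hq' : q = l*(q/l)) by (apply Z_div_exact_full_2; lia).
revert hq'; generalize (q/l); intros q' hq'.
assert (hp : 0 < q') by nia.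
apply in_flat_map; exists (u mod q'); split.
- apply ht.
  + rewrite hq', Z.odd_mul in ho; now apply Bool.andb_true_iff in ho.
  + nia.
  + now apply Z.mod_pos_bound.
  + apply charpoly_mod; auto; apply (Z.divide_trans _ q); auto.
    exists l; lia.
- assert (he : u = u mod q' + q'*(u/q')) by (generalize (Z.div_mod u q'); lia).
  rewrite he at 1; apply lifts_complete; [lia| |now rewrite <- he].
  split; [apply Z.div_pos; lia|]; rewrite Z2Nat.id by lia.
  apply Z.div_lt_upper_bound; lia.
Qed.

Fixpoint build (k : nat) (q : Z) (tab : table) : table :=
  match k with
  | O => tab
  | S k' => build k' (q+2) (PositiveMap.add (Z.to_pos q) (roots_mod tab q) tab)
  end.

Lemma build_complete k q tab :
  Z.odd q = true -> 1 <= q -> complete tab q -> complete (build k q tab) (q + 2*Z.of_nat k).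
Proof.
revert q tab; induction k as [|k IH]; intros q tab ho hq ht.
- now rewrite Z.mul_0_r, Z.add_0_r.
- cbn [build]; replace (q + 2*Z.of_nat (S k)) with ((q+2) + 2*Z.of_nat k) by lia.
  apply IH; [now rewrite Z.odd_add, ho | lia |].
  intros q' u ho' hq' hu hd; unfold get.
  destruct (Z.eq_dec q' q) as [->|hne].
  + rewrite PositiveMap.gss; now apply roots_mod_complete.
  + rewrite PositiveMap.gso by lia; apply ht; auto.
    enough (q' <> q + 1) by lia.
    intros ->; now rewrite Z.odd_add, ho in ho'.
Qed.

Definition root_table (B : Z) : table :=
  build (Z.to_nat ((B+1)/2)) 1 (PositiveMap.empty _).

Lemma root_table_complete B q u :
  Z.odd q = true -> 1 <= q <= B -> 0 <= u < q -> (q | charpoly n u) ->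
  In u (get (root_table B) q).
Proof.
intros ho hq; apply (build_complete _ 1); auto; [lia | intros ? ?; lia |].
rewrite Z2Nat.id by (apply Z.div_pos; lia).
(* The table holds the [(B+1)/2] odd moduli starting from 1, hence all those up to [B]. *)
assert (hB := Z.div_mod (B+1) 2 ltac:(lia)); generalize (Z.mod_pos_bound (B+1) 2); lia.
Qed.

End Roots.

(** * Enumeration of the Hessenberg matrices allowed by the index bound *)

Definition index_bound (n : Z) : Z := Z.sqrt (16 * disc n / 729).

(* Only odd indices p^2 q occur, and p^2 < 31^2. *)
Definition check (lo hi : Z) (paths : list path) (n : Z) : bool :=
  let B := index_bound n in
  let tab := root_table n B in
  if B <? 961 then
    forallb (fun p => if p*p <=? B then
      forallb (fun r => all_from (Z.to_nat ((B/(p*p)+1)/2)) 2 1 (fun q =>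
        forallb (fun u => all_from (Z.to_nat p) 1 0 (settled_at lo hi paths n p q r u))
          (get tab q))) (get tab p)
      else true) [1; 3; 5; 7; 9; 11; 13; 15; 17; 19; 21; 23; 25; 27; 29]
  else false.

Lemma check_sound lo hi paths n :
  6 <= n \/ n <= -1 -> (forall m, lo <= m <= hi -> known m) ->
  check lo hi paths n = true -> known n.
Proof.
intros hn hK hc A hA ht.
destruct (exists_hessenberg A hA)
  as [r [s [a [p [t [b [q [u [[hs hmin] [hp [hq [hr [hu hb]]]]]]]]]]]]].
set (H := Mat r s a p t b 0 q u) in *.
assert (hA' : isCS H) by now apply (sim_isCS A).
assert (ht' : tr H = n) by now rewrite (sim_tr A).
enough (G : exists c d, valid c d n /\ sim H (std c d n) /\ reach c d n).
{ destruct G as [c [d [h1 [h2 h3]]]]; exists c, d; split; auto; split; auto.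
  now apply (sim_trans _ H). }
apply (settled_at_sound lo hi paths n r s a p t b q u); auto.
assert (hb1 := hessenberg_bound r s a p t b q u n hn hA' ht' hmin hp hq).
destruct (hessenberg_roots _ _ _ _ _ _ _ _ _ hA' ht') as [hpr hqu].
assert (hodd : Z.odd p = true /\ Z.odd q = true).
{ assert (ho := iform_odd H 1 0 0 hA' eq_refl).
  replace (iform H (1, 0, 0)) with (p*p*q) in ho by (unfold H; mat_red; ring).
  rewrite !Z.odd_mul in ho; destruct (Z.odd p), (Z.odd q); auto. }
destruct hodd as [op oq].
assert (hm : p*p*q <= index_bound n).
{ apply Z.sqrt_le_square; [| nia |].
  - apply Z.div_pos; [nia | lia].
  - apply Z.div_le_lower_bound; lia. }
revert hc; unfold check; cbv zeta; generalize dependent (index_bound n); intros B hm.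
destruct (Z.ltb_spec B 961) as [hB|]; [|easy]; rewrite forallb_forall; intros hc.
assert (hpB : p*p <= B) by nia.
assert (hp31 : p < 31) by nia.
assert (hqB : q <= B/(p*p)) by (apply Z.div_le_lower_bound; nia).
assert (hin : In p [1; 3; 5; 7; 9; 11; 13; 15; 17; 19; 21; 23; 25; 27; 29]).
{ generalize (Z.div2_odd p); rewrite op; revert hp hp31; generalize (Z.div2 p); clear.
  cbn [Z.b2z In]; lia. }
specialize (hc p hin); rewrite (proj2 (Z.leb_le _ _) hpB), forallb_forall in hc.
specialize (hc r (root_table_complete n B p r op ltac:(nia) hr hpr)).
assert (hq2 : q = 2*(q/2) + 1).
{ rewrite (Z.div_mod q 2) at 1 by lia; now rewrite Zmod_odd, oq. }
(* The odd number [q] is entry [q/2] of the progression 1, 3, 5, ... *)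
apply (all_fromP _ _ _ _) with (j := q/2) in hc.
2: { rewrite Z2Nat.id by (apply Z.div_pos; lia); split; [apply Z.div_pos; lia|].
     apply Z.div_lt_upper_bound; [lia|].
     generalize (Z.div_mod (B/(p*p)+1) 2) (Z.mod_pos_bound (B/(p*p)+1) 2); lia. }
replace (1 + 2*(q/2)) with q in hc by lia.
rewrite forallb_forall in hc.
specialize (hc u (root_table_complete n B q u oq ltac:(nia) hu hqu)).
apply (all_fromP _ _ _ _) with (j := b) in hc; [|rewrite Z2Nat.id; lia].
now rewrite Z.mul_1_l in hc.
Qed.

(** * Induction on the trace *)

Lemma known_small n : 0 <= n <= 5 -> known n.
Proof.
intros hn A hA ht.
destruct (exists_hessenberg A hA)
  as [r [s [a [p [t [b [q [u [[hs hmin] [hp [hq [hr [hu hb]]]]]]]]]]]]].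
assert (hA' := sim_isCS _ _ hs hA).
assert (ht' := sim_tr _ _ hs); rewrite ht in ht'.
destruct (hessenberg_small _ _ _ _ _ _ _ _ n hn hA' ht' hmin hp hq) as [-> ->].
assert (r = 0) by lia; assert (u = 0) by lia; assert (b = 0) by lia; subst r u b.
destruct (hessenberg_char _ _ _ _ _ _ _ _ _ hA' ht') as [h1 [h2 h3]].
(* Index 1 leaves a single matrix for each trace, hence a single similarity class; it has a standard
   form with [d = 1], whose trace can be shifted freely to 2. *)
assert (t = n) by lia; assert (s = 1-n) by lia; assert (a = 1) by lia; subst t s a.
exists 1, 1; assert (hv : forall n, valid 1 1 n) by (split; [lia | apply Z.divide_1_l]).
split; [apply hv|split].
- apply (sim_trans _ _ _ hs).
  assert (hd : std_step (Mat 0 (1-n) 1 1 n 0 0 1 0) n (-1, 0, 0) 1 = 1).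
  { assert (H : n = 0 \/ n = 1 \/ n = 2 \/ n = 3 \/ n = 4 \/ n = 5) by lia.
    destruct H as [-> | [-> | [-> | [-> | [-> | ->]]]]]; reflexivity. }
  assert (hs' := std_step_sound (Mat 0 (1-n) 1 1 n 0 0 1 0) n (-1, 0, 0) 1).
  rewrite hd in hs'; exact (proj2 (hs' ltac:(discriminate))).
- apply (reach_shift _ _ _ 2); auto; [apply Z.divide_1_l | apply reach_A0].
Qed.

(* Found by computer search. An entry [(w, c, n')] replaces the current matrix, of trace
   [n], by its standard form [X_{c,d,n}] in a basis starting with [w], then [n] by [n']. *)
Definition paths_of (n : Z) : list path :=
  match n with
  | -73 => [[(-270789, -2507, 14060, 34, 112); (-702, 49, 9, 113, -31)];
    [(-4599, -40, 151, 41, 78); (-40, 4, 1, 111, -53)];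
    [(-4219, -38, 157, 38, 84); (180, 17, -4, 101, -53)];
    [(-334, -15, 23, 41, 78); (-40, 4, 1, 111, -53)];
    [(-222, -1, 1, 32, -2)];
    [(-1, -1, 1, 28, -44)]]
  | -69 => [[(2130, 27, -35, 42, 128); (-407, -23, 5, 75, -63)]]
  | -67 => [[(-13, -1, 1, 38, 138); (1787, 99, -18, 139, -89); (-2511, 18, -11, 70, 8)];
    [(13, 1, 2, 15, -38)]]
  | -66 => [[(-248677, -2414, 10281, 36, 83); (184, -17, -4, 45, -39)]]
  | -64 => [[(4790, 40, -129, 76, 147); (-639, 25, 9, 151, -122);
      (-22059014, -144380, -80505, 83, 29)]]
  | -63 => [[(-324515, -1726, 2456, 71, 34)];
    [(-1, -1, 1, 24, -38)];
    [(28, 3, 3, 51, -10)];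
    [(79458, 385, -513, 104, 202); (-603845, -15702, 6162, 290, -205);
      (-520240, -1475, -1051, 164, 72); (135109, -2469, 1453, 134, -133);
      (6433, -37, 24, 52, 94); (-1054263, -109629, 25108, 46, -3)]]
  | -62 => [[(-141, -5, 10, 88, 153); (-1088, -42, 17, 30, -104);
      (-1618222, -106255, -11986, 36, -3)];
    [(-1, -1, 1, 40, -21)];
    [(53, 1, -66, 14, -35)];
    [(1018, 66, -201, 14, 19)];
    [(2933, 121, -447, 161, 229); (-1768, -47, 26, 108, -168); (-330194, 4423, -1192, 24, -19)]]
  | -60 => [[(12, 64, 1, 2, -35)]]
  | -59 => [[(-1813, -76, 498, 35, 100); (-192, 14, 3, 58, 11)];
    [(-1, -1, 1, 38, -20)]]
  | -58 => [[(-1, -2, 0, 24, -9)]]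
  | -57 => [[(-1, -2, 0, 13, -32)]]
  | -56 => [[(-2707, -126, 176, 90, 83); (-51, -8, -5, 30, -78); (-17115, -872, -157, 39, 47)];
    [(-2125, -14, 22, 66, 47)];
    [(-1, -1, 1, 36, -19)]]
  | -53 => [[(-1903, -24, 63, 14, 112); (8, -1, 0, 75, -7)];
    [(-797, -37, 60, 14, 112); (8, 1, 0, 75, -7)];
    [(-1, -1, 1, 34, -18)];
    [(839, 42, -52, 86, 64); (183, 11, 8, 75, -45)];
    [(62425, 879, -6765, 17, 70); (7, 1, 0, 14, -24)]]
  | -52 => [[(-3682, -39, 109, 40, 57); (-80, 14, 5, 15, -22)]]
  | -51 => [[(238, 13, -19, 83, 56); (-193, 9, -7, 73, -33)];
    [(11123, 83, -107, 83, 56); (-193, -9, -7, 73, -33)]]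
  | -50 => [[(-3, 0, 1, 47, 25)];
    [(-1, -1, 1, 32, -17)];
    [(16, 1, -2, 51, 23)]]
  | -47 => [[(-349, -18, 46, 11, 56); (4, -1, 0, 75, -45)];
    [(-1, -1, 1, 30, -16)];
    [(12, 1, -3, 11, 16)]]
  | -44 => [[(-5, 0, 1, 70, 45)];
    [(-1, -1, 1, 28, -15)]]
  | -41 => [[(-1, -1, 1, 26, -14)]]
  | -38 => [[(-12, -1, 1, 39, 23)];
    [(-1, -1, 1, 24, -13)]]
  | -35 => [[(-1, -1, 1, 22, -12)]]
  | -32 => [[(-1, -1, 1, 20, -11)];
    [(14, 1, -2, 8, 19)]]
  | -29 => [[(-1, -1, 1, 18, -10)]]
  | -26 => [[(-1, -1, 1, 16, -9)]]
  | -23 => [[(-1, -1, 1, 14, -8)]]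
  | -20 => [[(-1, -1, 1, 12, -7)]]
  | -17 => [[(-1, -1, 1, 10, -6)]]
  | -14 => [[(1, 1, 0, 8, -5)]]
  | 19 => [[(1, 0, -1, 5, -8)]]
  | 22 => [[(7, -1, -2, 6, -11)]]
  | 25 => [[(8, -1, -2, 7, -14)]]
  | 28 => [[(9, -1, -2, 8, -17)]]
  | 31 => [[(10, -1, -2, 9, -20)]]
  | 34 => [[(11, -1, -2, 10, -23)]]
  | 37 => [[(-8, 1, -1, 23, -14)];
    [(12, -1, -2, 11, -26)]]
  | 40 => [[(13, -1, -2, 12, -29)]]
  | 43 => [[(-11, 1, -2, 54, -18)];
    [(14, -1, -2, 13, -32)]]
  | 46 => [[(15, -1, -2, 14, -35)]]
  | 49 => [[(-15, 1, -2, 41, -40)];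
    [(16, -1, -2, 15, -38)]]
  | 52 => [[(17, -1, -2, 16, -41)];
    [(629, -42, 53, 32, -51); (-253, -10, -3, 87, 50)]]
  | 55 => [[(-12, 1, -2, 20, -18)];
    [(2, 0, 1, 32, -20)];
    [(18, -1, -2, 17, -44)]]
  | 56 => [[(-1716, -78, 107, 78, -51); (653, 7, 5, 69, 38)];
    [(131, -4, 20, 78, -51); (653, 7, 5, 69, 38)]]
  | 57 => [[(575, -14, 109, 15, -52); (-9, -1, 0, 18, 27)]]
  | 58 => [[(-28189, 1704, -2857, 107, -59); (-152, 1, -1, 29, 50)];
    [(19, -2, 3, 53, -5)];
    [(19, -1, -2, 18, -47)];
    [(932, 37, -63, 128, -107); (-2361, 13, -10, 38, 12)];
    [(12723, -785, 3422, 128, -107); (-2361, -13, -10, 38, 12)];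
    [(243266, 5655, -6888, 101, -65); (-2172, -16, -13, 30, -18)]]
  | 61 => [[(20, -1, -2, 19, -50)];
    [(287, -17, 58, 26, -78); (-491, 26, -19, 51, 83); (162, 16, -5, 103, -42)];
    [(302, -11, 49, 85, -42)]]
  | 62 => [[(-23, 2, 2, 24, -38)]]
  | 63 => [[(-18, 2, 3, 33, -35)]]
  | 64 => [[(-37888, 2171, -3535, 146, -95); (-221, 1, -1, 26, -6)];
    [(21, -1, -2, 20, -53)]]
  | 65 => [[(12, 62, 1, 2, -35)]]
  | 67 => [[(-25, 2, 1, 26, -41)];
    [(22, -1, -2, 21, -56)];
    [(1582, -133, 201, 26, -14)];
    [(3755, -192, 320, 174, -148); (-3419994, -13159, -10588, 196, 109);
      (1395, -21, 16, 27, 8)];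
    [(109012, -5885, 12987, 272, -224); (16906102, 36527, 34016, 142, 173);
      (-5009, 470, 167, 14, 24)]]
  | 68 => [[(-34624, -587, 925, 248, -197); (43233, -104, 97, 170, 210);
      (24955, 1494, -624, 18, -67); (-190, -36, -11, 38, 138); (1787, -99, -18, 139, -89);
      (-2511, -18, -11, 70, 8)];
    [(-169, 6, -29, 80, -29)];
    [(1, 3, 0, 36, -38)];
    [(14, -1, -2, 13, -57)]]
  | 69 => [[(-4714, -393, 901, 167, -142); (5870, -24, 19, 218, 127); (371, 5, 4, 36, -24)]]
  | 71 => [[(-560798, -9043, 10132, 133, -78); (-188, -1, -1, 44, -17)]]
  | 72 => [[(1, 1, 0, 28, -44)];
    [(12, -1, 2, 134, -133); (6433, 37, 24, 52, 94); (-1054263, 109629, 25108, 46, -3)]]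
  | 74 => [[(60, 1, -2, 174, -123); (-15740, -60, -53, 112, 68)]]
  | 78 => [[(-1004, 16, -157, 18, -79); (-11, 1, 0, 38, 58)];
    [(-342, 9, -67, 56, -64)];
    [(16, -1, -2, 15, -38)];
    [(454, -9, 49, 35, -73); (-219, 9, -2, 107, 58)];
    [(1429, -34, 151, 35, -73); (-219, -9, -2, 107, 58)];
    [(12716, 156, -185, 158, -107); (-11090, 49, -42, 84, 36)]]
  | _ => []
  end.

(** With [k] running from 5 to 68, the window [[5-k, k]], symmetric about 5/2, grows by one trace at
    each end. *)
Lemma check_sweep : all_from 64 1 5 (fun k =>
  if check (5-k) k (paths_of (k+1)) (k+1) then check (5-k) k (paths_of (4-k)) (4-k)
  else false) = true.
Proof. vm_cast_no_check (eq_refl true). Qed.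

Lemma check_sporadic :
  forallb (fun n => check (-64) 69 (paths_of n) n) [-73; -69; -67; -66; 71; 72; 74; 78] = true.
Proof. vm_cast_no_check (eq_refl true). Qed.

Lemma known_sweep n : -64 <= n <= 69 -> known n.
Proof.
assert (H : forall k : nat, (k <= 64)%nat ->
  forall n, -Z.of_nat k <= n <= 5 + Z.of_nat k -> known n).
{ induction k as [|k IH]; intros hk m hm; [apply known_small; lia|].
  assert (hK : forall m, 5 - (5 + Z.of_nat k) <= m <= 5 + Z.of_nat k -> known m).
  { intros m' hm'; apply IH; lia. }
  assert (hc := all_fromP _ _ _ _ check_sweep (Z.of_nat k) ltac:(lia)); cbv beta in hc.
  rewrite Z.mul_1_l in hc.
  destruct (check _ _ _ (5 + Z.of_nat k + 1)) eqn:h1; [|easy].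
  destruct (Z.eq_dec m (5 + Z.of_nat k + 1)) as [->|];
    [|destruct (Z.eq_dec m (4 - (5 + Z.of_nat k))) as [->|]].
  - apply (check_sound _ _ _ _) in h1; auto; lia.
  - apply (check_sound _ _ _ _) in hc; auto; lia.
  - apply IH; lia. }
intros hn; apply (H 64%nat); lia.
Qed.

Lemma known_sporadic n : In n [-73; -69; -67; -66; 71; 72; 74; 78] -> known n.
Proof.
intros hn.
refine (check_sound _ _ _ _ _ known_sweep (proj1 (forallb_forall _ _) check_sporadic n hn)).
cbn in hn; lia.
Qed.

(** * Transfer to matrices over int *)

Require Import Defs.
From HB Require Import structures.
From mathcomp Require Import all_boot all_order all_algebra.
From mathcomp Require Import ssrZ zify ring.
Import Order.TTheory GRing.Theory Num.Theory.
Local Open Scope ring_scope.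

Lemma int_of_ZD x y : int_of_Z (x + y)%Z = int_of_Z x + int_of_Z y.
Proof. exact: (raddfD int_of_Z). Qed.
Lemma int_of_ZN x : int_of_Z (- x)%Z = - int_of_Z x.
Proof. exact: (raddfN int_of_Z). Qed.
Lemma int_of_ZB x y : int_of_Z (x - y)%Z = int_of_Z x - int_of_Z y.
Proof. exact: (raddfB int_of_Z). Qed.
Lemma int_of_ZM x y : int_of_Z (x * y)%Z = int_of_Z x * int_of_Z y.
Proof. exact: (rmorphM int_of_Z). Qed.
Definition int_of_ZE := (int_of_ZD, int_of_ZB, int_of_ZN, int_of_ZM).

Definition mx_of_mat (A : mat) : 'M[int]_3 :=
  let (a, b, c, d, e, f, g, h, i) := A in
  mx3 (int_of_Z a) (int_of_Z b) (int_of_Z c) (int_of_Z d) (int_of_Z e) (int_of_Z f)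
    (int_of_Z g) (int_of_Z h) (int_of_Z i).

Definition mat_of_mx (A : 'M[int]_3) : mat :=
  let f (i j : nat) := Z_of_int (A (inord i) (inord j)) in
  Mat (f 0 0) (f 0 1) (f 0 2) (f 1 0) (f 1 1) (f 1 2) (f 2 0) (f 2 1) (f 2 2).

Lemma mat_of_mxK : cancel mat_of_mx mx_of_mat.
Proof.
move=> A; apply/matrixP => i j; rewrite mxE.
rewrite -[in RHS](inord_val i) -[in RHS](inord_val j).
by case: i => -[|[|[|//]]] ?; case: j => -[|[|[|//]]] ? /=; rewrite Z_of_intK.
Qed.

Lemma mul_mx3 (a b c d e f g h i a' b' c' d' e' f' g' h' i' : int) :
  mx3 a b c d e f g h i *m mx3 a' b' c' d' e' f' g' h' i' =
  mx3 (a*a'+b*d'+c*g') (a*b'+b*e'+c*h') (a*c'+b*f'+c*i')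
      (d*a'+e*d'+f*g') (d*b'+e*e'+f*h') (d*c'+e*f'+f*i')
      (g*a'+h*d'+i*g') (g*b'+h*e'+i*h') (g*c'+h*f'+i*i').
Proof.
apply/matrixP => j k; rewrite !mxE !big_ord_recl big_ord0 !mxE addr0 addrA.
by case: j => -[|[|[|//]]] ?; case: k => -[|[|[|//]]] ?.
Qed.

Lemma det_mx3 (a b c d e f g h i : int) :
  \det (mx3 a b c d e f g h i) = a*(e*i-f*h) - b*(d*i-f*g) + c*(d*h-e*g).
Proof.
rewrite (expand_det_row _ ord0) !big_ord_recl big_ord0 /cofactor.
rewrite !(expand_det_row _ ord0) !big_ord_recl !big_ord0 /cofactor !det_mx11 !mxE /=.
by ring.
Qed.

Lemma mx_of_matM A B : mx_of_mat (mat_mul A B) = mx_of_mat A *m mx_of_mat B.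
Proof. by case: A => *; case: B => *; rewrite /= mul_mx3 !int_of_ZE. Qed.

Lemma mx_of_mat_det A : \det (mx_of_mat A) = int_of_Z (det A).
Proof. by case: A => *; rewrite /= det_mx3 !int_of_ZE. Qed.

Lemma mx_of_mat_sub1 A : mx_of_mat (sub1 A) = mx_of_mat A - 1%:M.
Proof.
case: A => * /=; rewrite !int_of_ZE; apply/matrixP => i j; rewrite !mxE.
by case: i => -[|[|[|//]]] ?; case: j => -[|[|[|//]]] ?; rewrite /= ?subr0.
Qed.

Lemma mx_of_mat_tr A : \tr (mx_of_mat A) = int_of_Z (tr A).
Proof.
case: A => *; rewrite /mxtrace !big_ord_recl big_ord0 !mxE /= addr0 addrA.
by rewrite /tr /= !int_of_ZE.
Qed.

Lemma sim_similar3 A B : sim A B -> similar3 (mx_of_mat A) (mx_of_mat B).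
Proof.
case=> P [dP hP]; exists (mx_of_mat P).
have dP' : \det (mx_of_mat P) = 1 by rewrite mx_of_mat_det dP.
split=> //; rewrite -mx_of_matM hP mx_of_matM mulmxK //.
by rewrite unitmxE dP' unitr1.
Qed.

Lemma isCS_mat_of_mx A : isCSmx A -> isCS (mat_of_mx A).
Proof.
case=> d1 d2; split; apply: (can_inj int_of_ZK).
- by rewrite -mx_of_mat_det mat_of_mxK.
- by rewrite -mx_of_mat_det mx_of_mat_sub1 mat_of_mxK.
Qed.

Lemma fCS_int_of_Z n c : fCS (int_of_Z n) (int_of_Z c) = int_of_Z (charpoly n c).
Proof. by rewrite /charpoly !int_of_ZE /fCS; ring. Qed.

Lemma inCS_valid c d n :
  inCS (int_of_Z c) (int_of_Z d) (int_of_Z n) <-> valid c d n.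
Proof.
rewrite /inCS fCS_int_of_Z; split=> -[hd hdiv]; split.
- by move=> e; move: hd; rewrite e.
- case/dvdzP: hdiv => k hk; exists (Z_of_int k).
  by apply: (can_inj int_of_ZK); rewrite int_of_ZM Z_of_intK.
- by apply/eqP => e; apply: hd; apply: (can_inj int_of_ZK).
- by case: hdiv => k ->; rewrite int_of_ZM dvdz_mull.
Qed.

(** Validity makes the division by [d] exact, so the rounding conventions of the two integer
    divisions cannot differ. *)
Lemma mx_of_mat_std c d n : valid c d n ->
  mx_of_mat (std c d n) = Xmx (int_of_Z c) (int_of_Z d) (int_of_Z n).
Proof.
move=> hv; have [hd' _] := (inCS_valid c d n).2 hv; case: hv => hd [k hk].
rewrite /Xmx fCS_int_of_Z /std hk Z.div_mul // int_of_ZM mulzK //=.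
by rewrite !int_of_ZE.
Qed.

Lemma reach_gompf c d n : reach c d n ->
  gompf_equiv (int_of_Z c, int_of_Z d, int_of_Z n) (1, 1, 2).
Proof.
elim=> {c d n} [|c d c' d' n hv hv' hs _|c d n n' hv hv' [k hk] _].
- exact: rst_refl.
- apply: rst_trans; apply: rst_step; split; first exact/inCS_valid.
  split; first exact/inCS_valid.
  by left; rewrite -!mx_of_mat_std //; apply: sim_similar3.
- apply: rst_trans; apply: rst_step; split; first exact/inCS_valid.
  split; first exact/inCS_valid.
  right; split=> //; split=> //; exists (int_of_Z k).
  by have -> : n' = (n + k * d)%Z by [lia]; rewrite int_of_ZD int_of_ZM.
Qed.

Theorem theorem5 (n : int) :
  ((-64 <= n <= 69) \/ n \in [:: -73; -69; -67; -66; 71; 72; 74; 78]) ->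
  (forall A : 'M[int]_3, isCSmx A -> \tr A = n -> gompf_equiv_A0 A) /\
  (forall c d : int, inCS c d n -> gompf_equiv (c, d, n) (1, 1, 2)).
Proof.
move=> hn.
have hK : known (Z_of_int n).
  case: hn => [hn|]; first by apply: known_sweep; lia.
  by rewrite !inE => hn; apply: known_sporadic; rewrite /In; lia.
split=> [A hA ht|c d hcd].
- have ht' : tr (mat_of_mx A) = Z_of_int n.
    by apply: (can_inj int_of_ZK); rewrite -mx_of_mat_tr mat_of_mxK Z_of_intK.
  have [c [d [hv [hs hr]]]] := hK _ (isCS_mat_of_mx A hA) ht'.
  exists (int_of_Z c), (int_of_Z d), (int_of_Z (Z_of_int n)).
  split; first exact/inCS_valid.
  split; last exact: reach_gompf.
  by rewrite -mx_of_mat_std // -{1}(mat_of_mxK A); apply: sim_similar3.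
- rewrite -(Z_of_intK c) -(Z_of_intK d) -(Z_of_intK n); apply: reach_gompf.
  by apply: known_reach => //; apply/inCS_valid; rewrite !Z_of_intK.
Qed.
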